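(* Consider an execution of the DRL transition system and let $Q$ be a finalized set of snapshots taken in it. Then $Q$ is strongly finalized: for all $B\in\mathrm{dom}(Q)$ and all refobs $x: A\to B$, $Q\vdash\mathrm{Unreleased}(x)$ implies $Q\vdash\mathrm{Relevant}(x)$.
   Context: DRL transition system. Refobs are triples $x: A\to B$ (token $x$, owner $A$, target $B$). Facts: $\mathrm{Created}(x)$, $\mathrm{Released}(x)$, $\mathrm{CreatedUsing}(x,y)$, $\mathrm{Activated}(x)$, $\mathrm{Unreleased}(x)$, $\mathrm{SentCount}(x,n)$, $\mathrm{RecvCount}(x,n)$. A knowledge set $\Phi$ is a finite set of facts; $\Phi\vdash\varphi$ means derivability in first-order logic plus: if no $\mathrm{SentCount}(x,n)\in\Phi$ then $\Phi\vdash\mathrm{SentCount}(x,0)$; likewise for $\mathrm{RecvCount}$; $\Phi\vdash\mathrm{Created}(x)\wedge\neg\mathrm{Released}(x)$ gives $\Phi\vdash\mathrm{Unreleased}(x)$; $\Phi\vdash\mathrm{CreatedUsing}(x,y)$ gives $\Phi\vdash\mathrm{Created}(y)$. $\mathrm{IncSent}/\mathrm{IncRecv}(x,\Phi)$ increment (or create with value $1$) the corresponding count. Messages: $\mathrm{App}(x,R)$, $\mathrm{Info}(y,z,B)$, $\mathrm{Release}(x,n)$. A configuration $(\alpha,\mu,\rho,\chi)$: $\alpha$ maps internal actors to busy $[\Phi]$ or idle $(\Phi)$ states; $\mu$ gives undelivered messages of each actor; receptionists $\rho\subseteq\mathrm{dom}(\alpha)$; external actors $\chi$. Initial configuration: one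 busy actor $A$ with $\{\mathrm{Activated}(x:A\to E),\mathrm{Created}(y:A\to A),\mathrm{Activated}(y:A\to A)\}$, no messages, $\rho=\emptyset$, $\chi=\{E\}$. Events: Spawn$(x,A,B)$: busy $A$, fresh $x,y,B$; $A$ adds $\mathrm{Activated}(x:A\to B)$; new busy $B$ with $\{\mathrm{Created}(x:A\to B),\mathrm{Created}(y:B\to B),\mathrm{Activated}(y:B\to B)\}$. Send$(x,\vec y,\vec z,A,B,\vec C)$: busy $A$ with $\Phi\vdash\mathrm{Activated}(x:A\to B)$ and $\Phi\vdash\mathrm{Activated}(y_i:A\to C_i)$, fresh $z_i$; $A$'s set becomes $\mathrm{IncSent}(x,\Phi)\cup\{\mathrm{CreatedUsing}(y_i,z_i)\}$; $\mathrm{App}(x,\{z_i:B\to C_i\})$ sent to $B$. Receive$(x,B,R)$: idle $B$ consumes $\mathrm{App}(x,R)$, becomes busy with $\mathrm{IncRecv}(x,\Phi)\cup\{\mathrm{Activated}(z):z\in R\}$. Idle$(A)$: busy $A$ becomes idle. SendInfo$(y,z,A,B,C)$: busy $A$ containing $\mathrm{CreatedUsing}(y:A\to C,z:B\to C)$ removes it, increments send count of $y$, sends $\mathrm{Info}(y,z,B)$ to $C$. Info$(y,z,B,C)$: idle $C$ consumes it, stays idle with $\mathrm{IncRecv}(y,\Phi)\cup\{\mathrm{Created}(z:B\to C)\}$. SendRelease$(x,A,B)$: busy $A$ with set $\Phi\cup\{\mathrm{Activated}(x:A\to B),\mathrm{SentCount}(x,n)\}$, no $\mathrm{CreatedUsing}(x,y)\in\Phi$: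 set becomes $\Phi$; sends $\mathrm{Release}(x,n)$ to $B$. Release$(x,A,B)$: idle $B$ consumes $\mathrm{Release}(x,n)$ only if $\Phi\vdash\mathrm{RecvCount}(x,n)$; adds $\mathrm{Released}(x)$. Compaction$(x,B,C)$: idle $C$ containing $\mathrm{Created}(x:B\to C),\mathrm{Released}(x)$ removes them and any $\mathrm{RecvCount}(x,n)$. Snapshot$(A,\Phi)$: idle $A$; no change; records $\Phi$ as $A$'s snapshot. In$(x,A,R)$: $A\in\rho$ receives from outside $\mathrm{App}(x,R)$ with fresh refobs owned by $A$ whose internal targets lie in $\rho$; external targets join $\chi$. Out$(x,B,R)$: $B\in\chi$ consumes $\mathrm{App}(x,R)$; internal targets of $R$ join $\rho$. ReleaseOut/InfoOut: Release/Info messages to external actors are dropped. A set of snapshots $Q$ maps (internal) actors to knowledge sets recorded by their Snapshot events in the execution (at most one per actor). For a refob $x:A\to B$: $Q\vdash\mathrm{Activated}(x)$, $Q\vdash\mathrm{SentCount}(x,n)$, $Q\vdash\mathrm{CreatedUsing}(x,y)$ mean $A\in\mathrm{dom}(Q)$ and $Q(A)$ derives the fact; $Q\vdash\mathrm{Created}(x)$, $Q\vdash\mathrm{Released}(x)$, $Q\vdash\mathrm{RecvCount}(x,n)$ mean $B\in\mathrm{dom}(Q)$ and $Q(B)$ derives the fact. $Q\vdash\mathrm{Unreleased}(x)$ iff $Q\not\vdash\mathrm{Released}(x)$ and either $Q\vdash\mathrm{Created}(x)$ or $Q(C)\vdash\mathrm{CreatedUsing}(y,x)$ for some $C\in\mathrm{dom}(Q)$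 and some refob $y$. $Q\vdash\mathrm{Chain}(x:A\to B)$ iff there are refobs $x_1:A_1\to B,\dots,x_n:A_n\to B$ with $Q\vdash\mathrm{Created}(x_1)$, $Q\not\vdash\mathrm{Released}(x_1)$, for all $i<n$ $Q\vdash\mathrm{CreatedUsing}(x_i,x_{i+1})$ and $Q\not\vdash\mathrm{Released}(x_{i+1})$, and $A_n=A$, $x_n=x$. $Q\vdash\mathrm{Relevant}(x)$ iff for some $n$, $Q\vdash\mathrm{Activated}(x)$, $Q\vdash\mathrm{SentCount}(x,n)$, $Q\vdash\mathrm{RecvCount}(x,n)$. $Q$ is finalized if for all $B\in\mathrm{dom}(Q)$ and all $x:A\to B$, $Q\vdash\mathrm{Chain}(x)$ implies $A\in\mathrm{dom}(Q)$ and $Q\vdash\mathrm{Relevant}(x)$. *)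

(* Defs.v *)
From HB Require Import structures.
From mathcomp Require Import all_boot finmap multiset.
From Stdlib Require List.

Set Implicit Arguments.
Unset Strict Implicit.
Unset Printing Implicit Defensive.

Local Open Scope fset_scope.
Local Open Scope fmap_scope.

(* Refob t A B is the reference object t : A -> B, owned by A, targeting B. *)
Record refob (Token Actor : choiceType) :=
  Refob { token : Token; owner : Actor; target : Actor }.

Section RefobChoice.
Variables Token Actor : choiceType.
Let enc (x : refob Token Actor) := (token x, owner x, target x).
Let dec (p : Token * Actor * Actor) := Refob p.1.1 p.1.2 p.2.
Fact refob_encK : cancel enc dec. Proof. by case. Qed.
HB.instance Definition _ := Choice.copy (refob Token Actor) (can_type refob_encK).
End RefobChoice.

Inductive fact (Token Actor : choiceType) :=
| Created of refob Token Actor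
| Released of refob Token Actor
| CreatedUsing of refob Token Actor & refob Token Actor
| Activated of refob Token Actor
| Unreleased of refob Token Actor
| SentCount of refob Token Actor & nat
| RecvCount of refob Token Actor & nat.

Section FactChoice.
Variables Token Actor : choiceType.
Notation leafT := (refob Token Actor + nat)%type.
Notation leaf x := (GenTree.Leaf (inl x)).
Notation leafn n := (GenTree.Leaf (inr n)).
Let enc (f : fact Token Actor) : GenTree.tree leafT :=
  match f with
  | Created x => GenTree.Node 0 [:: leaf x]
  | Released x => GenTree.Node 1 [:: leaf x]
  | CreatedUsing x y => GenTree.Node 2 [:: leaf x; leaf y]
  | Activated x => GenTree.Node 3 [:: leaf x]
  | Unreleased x => GenTree.Node 4 [:: leaf x]
  | SentCount x n => GenTree.Node 5 [:: leaf x; leafn n]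
  | RecvCount x n => GenTree.Node 6 [:: leaf x; leafn n]
  end.
Let dec (t : GenTree.tree leafT) : option (fact Token Actor) :=
  match t with
  | GenTree.Node 0 [:: leaf x] => Some (Created x)
  | GenTree.Node 1 [:: leaf x] => Some (Released x)
  | GenTree.Node 2 [:: leaf x; leaf y] => Some (CreatedUsing x y)
  | GenTree.Node 3 [:: leaf x] => Some (Activated x)
  | GenTree.Node 4 [:: leaf x] => Some (Unreleased x)
  | GenTree.Node 5 [:: leaf x; leafn n] => Some (SentCount x n)
  | GenTree.Node 6 [:: leaf x; leafn n] => Some (RecvCount x n)
  | _ => None
  end.
Fact fact_encK : pcancel enc dec. Proof. by case. Qed.
HB.instance Definition _ := Choice.copy (fact Token Actor) (pcan_type fact_encK).
End FactChoice.

Notation kset Token Actor := {fset fact Token Actor}.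

(* App x R: application message sent along x, carrying the refobs R.
   Info y z: the paper's Info(y, z, B); B is owner z.
   Release x n: x was released after n messages had been sent along it. *)
Inductive msg (Token Actor : choiceType) :=
| App of refob Token Actor & {fset refob Token Actor}
| Info of refob Token Actor & refob Token Actor
| Release of refob Token Actor & nat.

Section MsgChoice.
Variables Token Actor : choiceType.
Notation R := (refob Token Actor).
Notation codeT := (R * {fset R} + R * R + R * nat)%type.
Let enc (m : msg Token Actor) : codeT :=
  match m with
  | App x zs => inl (inl (x, zs))
  | Info y z => inl (inr (y, z))
  | Release x n => inr (x, n)
  end.
Let dec (c : codeT) : msg Token Actor :=
  match c with
  | inl (inl (x, zs)) => App x zs
  | inl (inr (y, z)) => Info y z
  | inr (x, n) => Release x n
  end.
Fact msg_encK : cancel enc dec. Proof. by case. Qed.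
HB.instance Definition _ := Choice.copy (msg Token Actor) (can_type msg_encK).
End MsgChoice.

Section DRL.
Variables Token Actor : choiceType.

Local Notation refob := (refob Token Actor).
Local Notation fact := (fact Token Actor).
Local Notation kset := (kset Token Actor).
Local Notation msg := (msg Token Actor).

Implicit Types (t u : Token) (A B C E : Actor) (x y z : refob) (f : fact).
Implicit Types (Phi : kset) (m : msg) (R : {fset refob}).

(* Phi |- f.  The premise "not Released x" of derives_unreleased is negation
   as failure; since membership is the only rule concluding Released x, it
   amounts to non-membership. *)
Inductive derives Phi : fact -> Prop :=
| derives_mem f : f \in Phi -> derives Phi f
| derives_sent0 x :
    (forall n, SentCount x n \notin Phi) -> derives Phi (SentCount x 0)
| derives_recv0 x :
    (forall n, RecvCount x n \notin Phi) -> derives Phi (RecvCount x 0)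
| derives_unreleased x :
    derives Phi (Created x) -> Released x \notin Phi ->
    derives Phi (Unreleased x)
| derives_created x y :
    derives Phi (CreatedUsing x y) -> derives Phi (Created y).

Definition is_sent x f := if f is SentCount y _ then y == x else false.
Definition is_recv x f := if f is RecvCount y _ then y == x else false.

Definition incr_count f :=
  match f with
  | SentCount x n => SentCount x n.+1
  | RecvCount x n => RecvCount x n.+1
  | _ => f
  end.

Definition inc_sent x Phi : kset :=
  if has (is_sent x) Phi
  then [fset (if is_sent x f then incr_count f else f) | f in Phi]
  else SentCount x 1 |` Phi.

Definition inc_recv x Phi : kset :=
  if has (is_recv x) Phi
  then [fset (if is_recv x f then incr_count f else f) | f in Phi]
  else RecvCount x 1 |` Phi.

Inductive actor_state := Busy of kset | Idle of kset.

Definition knowledge (s : actor_state) : kset :=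
  match s with Busy Phi | Idle Phi => Phi end.

(* (B, m) occurs in [undelivered] once for each undelivered copy of the message
   m addressed to B; delivery is unordered. *)
Record config := Config {
  actors : {fmap Actor -> actor_state};
  undelivered : {mset (Actor * msg)}%mset;
  receptionists : {fset Actor};
  externals : {fset Actor}
}.

Implicit Types (alpha : {fmap Actor -> actor_state}).
Implicit Types (mu : {mset (Actor * msg)}%mset) (rho chi : {fset Actor}).

Definition fact_refobs f : seq refob :=
  match f with
  | CreatedUsing x y => [:: x; y]
  | Created x | Released x | Activated x | Unreleased x
  | SentCount x _ | RecvCount x _ => [:: x]
  end.

Definition msg_refobs m : seq refob :=
  match m with
  | App x R => x :: R
  | Info y z => [:: y; z]
  | Release x _ => [:: x]
  end.

Definition occurs_refob (k : config) x : Prop :=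
  (exists A s f, [/\ (actors k).[? A] = Some s, f \in knowledge s
                   & x \in fact_refobs f]) \/
  (exists B m, (B, m) \in undelivered k /\ x \in msg_refobs m).

Definition occurs_actor (k : config) A : Prop :=
  [\/ A \in domf (actors k), A \in externals k,
      exists m, (A, m) \in undelivered k
    | exists2 x, occurs_refob k x & A = owner x \/ A = target x].

(* Freshness is relative to the list h of all configurations visited so far,
   not just the current one: after Compaction all traces of a refob may have
   disappeared from the configuration, but its token must not be reused. *)
Definition fresh_token (h : seq config) t : Prop :=
  forall k x, List.In k h -> occurs_refob k x -> token x <> t.

Definition fresh_actor (h : seq config) A : Prop :=
  forall k, List.In k h -> ~ occurs_actor k A.

(* Refobs carry their owner and target, so labels omit the actor arguments
   that are determined by their refob arguments. *)
Inductive event :=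
| ESpawn of refob
| ESend of refob & seq refob & seq refob
| EReceive of refob & {fset refob}
| EIdle of Actor
| ESendInfo of refob & refob
| EInfo of refob & refob
| ESendRelease of refob
| ERelease of refob
| ECompaction of refob
| ESnapshot of Actor & kset
| EIn of refob & {fset refob}
| EOut of refob & {fset refob}
| EReleaseOut of refob & nat
| EInfoOut of refob & refob.

(* The refobs z_i : B -> C_i created by Send with tokens ts, where ys are the
   y_i : A -> C_i. *)
Definition new_refobs B (ys : seq refob) (ts : seq Token) : seq refob :=
  [seq Refob p.2 B (target p.1) | p <- zip ys ts].

Inductive step (h : seq config) : config -> event -> config -> Prop :=
| StepSpawn alpha mu rho chi A B t u Phi :
    let x := Refob t A B in
    let y := Refob u B B in
    alpha.[? A] = Some (Busy Phi) ->
    t <> u -> fresh_token h t -> fresh_token h u -> fresh_actor h B ->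
    step h
      (Config alpha mu rho chi)
      (ESpawn x)
      (Config (alpha.[A <- Busy (Activated x |` Phi)]
                    .[B <- Busy [fset Created x; Created y; Activated y]])
              mu rho chi)
| StepSend alpha mu rho chi A x (ys : seq refob) (ts : seq Token) Phi :
    let zs := new_refobs (target x) ys ts in
    alpha.[? A] = Some (Busy Phi) ->
    owner x = A -> derives Phi (Activated x) ->
    (forall y, y \in ys -> owner y = A /\ derives Phi (Activated y)) ->
    size ts = size ys -> uniq ts ->
    (forall t, t \in ts -> fresh_token h t) ->
    step h
      (Config alpha mu rho chi)
      (ESend x ys zs)
      (Config alpha.[A <- Busy (inc_sent x Phi `|`
                     [fset CreatedUsing p.1 p.2 | p in zip ys zs])]
              ((target x, App x [fset z in zs]) +` mu)%mset rho chi)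
| StepReceive alpha mu rho chi B x R Phi :
    alpha.[? B] = Some (Idle Phi) ->
    target x = B -> (B, App x R) \in mu ->
    step h
      (Config alpha mu rho chi)
      (EReceive x R)
      (Config alpha.[B <- Busy (inc_recv x Phi `|`
                     [fset Activated z | z in R])]
              (mu `\ (B, App x R))%mset rho chi)
| StepIdle alpha mu rho chi A Phi :
    alpha.[? A] = Some (Busy Phi) ->
    step h
      (Config alpha mu rho chi)
      (EIdle A)
      (Config alpha.[A <- Idle Phi] mu rho chi)
| StepSendInfo alpha mu rho chi A y z Phi :
    alpha.[? A] = Some (Busy Phi) ->
    owner y = A -> target z = target y -> CreatedUsing y z \in Phi ->
    step h
      (Config alpha mu rho chi)
      (ESendInfo y z)
      (Config alpha.[A <- Busy (inc_sent y (Phi `\ CreatedUsing y z))]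
              ((target y, Info y z) +` mu)%mset rho chi)
| StepInfo alpha mu rho chi C y z Phi :
    alpha.[? C] = Some (Idle Phi) ->
    target z = C -> (C, Info y z) \in mu ->
    step h
      (Config alpha mu rho chi)
      (EInfo y z)
      (Config alpha.[C <- Idle (Created z |` inc_recv y Phi)]
              (mu `\ (C, Info y z))%mset rho chi)
(* A refob that was never used has no SentCount fact; its count is then the
   derivable 0, and removing SentCount x 0 has no effect. *)
| StepSendRelease alpha mu rho chi A x n Phi :
    alpha.[? A] = Some (Busy Phi) ->
    owner x = A -> Activated x \in Phi -> derives Phi (SentCount x n) ->
    (forall y, CreatedUsing x y \notin Phi) ->
    step h
      (Config alpha mu rho chi)
      (ESendRelease x)
      (Config alpha.[A <- Busy (Phi `\ Activated x `\ SentCount x n)]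
              ((target x, Release x n) +` mu)%mset rho chi)
| StepRelease alpha mu rho chi B x n Phi :
    alpha.[? B] = Some (Idle Phi) ->
    target x = B -> (B, Release x n) \in mu -> derives Phi (RecvCount x n) ->
    step h
      (Config alpha mu rho chi)
      (ERelease x)
      (Config alpha.[B <- Idle (Released x |` Phi)]
              (mu `\ (B, Release x n))%mset rho chi)
| StepCompaction alpha mu rho chi C x Phi :
    alpha.[? C] = Some (Idle Phi) ->
    target x = C -> Created x \in Phi -> Released x \in Phi ->
    step h
      (Config alpha mu rho chi)
      (ECompaction x)
      (Config alpha.[C <- Idle [fset f in Phi `\ Created x `\ Released x
                                | ~~ is_recv x f]]
              mu rho chi)
| StepSnapshot alpha mu rho chi A Phi :
    alpha.[? A] = Some (Idle Phi) ->
    step h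
      (Config alpha mu rho chi)
      (ESnapshot A Phi)
      (Config alpha mu rho chi)
(* The message comes from outside, so the refob x it is sent along is owned by
   an actor that is not internal.  External actors' knowledge is not modelled:
   x is otherwise arbitrary, possibly unseen before. *)
| StepIn alpha mu rho chi A x R :
    A \in rho -> target x = A -> owner x \notin domf alpha ->
    (forall z, z \in R -> owner z = A /\ fresh_token h (token z)) ->
    {in R &, injective (@token Token Actor)} ->
    (forall z, z \in R -> target z \in domf alpha -> target z \in rho) ->
    step h
      (Config alpha mu rho chi)
      (EIn x R)
      (Config alpha ((A, App x R) +` mu)%mset rho
              (chi `|` [fset target z | z in R & target z \notin domf alpha]))
| StepOut alpha mu rho chi B x R :
    B \in chi -> target x = B -> (B, App x R) \in mu ->
    step h
      (Config alpha mu rho chi)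
      (EOut x R)
      (Config alpha (mu `\ (B, App x R))%mset
              (rho `|` [fset target z | z in R & target z \in domf alpha]) chi)
| StepReleaseOut alpha mu rho chi B x n :
    B \in chi -> (B, Release x n) \in mu ->
    step h
      (Config alpha mu rho chi)
      (EReleaseOut x n)
      (Config alpha (mu `\ (B, Release x n))%mset rho chi)
| StepInfoOut alpha mu rho chi B y z :
    B \in chi -> (B, Info y z) \in mu ->
    step h
      (Config alpha mu rho chi)
      (EInfoOut y z)
      (Config alpha (mu `\ (B, Info y z))%mset rho chi).

Definition initial_config A E t u : config :=
  let x := Refob t A E in
  let y := Refob u A A in
  Config [fmap].[A <- Busy [fset Activated x; Created y; Activated y]]
         mset0 fset0 [fset E].

Definition initial (k : config) : Prop :=
  exists A E t u, [/\ A <> E, t <> u & k = initial_config A E t u].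

(* [execution k0 tr]: tr lists, in order, the events of a (finite) execution
   from k0, each with the configuration it leads to. *)
Inductive execution (k0 : config) : seq (event * config) -> Prop :=
| ExecNil : initial k0 -> execution k0 [::]
| ExecStep tr e k :
    execution k0 tr ->
    step (k0 :: unzip2 tr) (last k0 (unzip2 tr)) e k ->
    execution k0 (rcons tr (e, k)).

Definition snapshots := {fmap Actor -> kset}.

Implicit Type Q : snapshots.

Definition taken_in Q (tr : seq (event * config)) : Prop :=
  forall A Phi, Q.[? A] = Some Phi -> List.In (ESnapshot A Phi) (unzip1 tr).

(* Q(A) |- f, which entails A \in dom(Q). *)
Definition derives_at Q A f : Prop :=
  exists2 Phi, Q.[? A] = Some Phi & derives Phi f.

Definition Qderives Q f : Prop :=
  match f with
  | Activated x | SentCount x _ | CreatedUsing x _ => derives_at Q (owner x) f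
  | Created x | Released x | RecvCount x _ => derives_at Q (target x) f
  | Unreleased x =>
      ~ derives_at Q (target x) (Released x) /\
      (derives_at Q (target x) (Created x) \/
       exists C y, derives_at Q C (CreatedUsing y x))
  end.

(* The chain is x1 :: s, a nonempty sequence ending in x. *)
Definition chain Q x : Prop :=
  exists x1 (s : seq refob),
    [/\ last x1 s = x,
        forall y, y \in x1 :: s -> target y = target x,
        Qderives Q (Created x1) /\ ~ Qderives Q (Released x1)
      & forall i, i < size s ->
          Qderives Q (CreatedUsing (nth x1 (x1 :: s) i) (nth x1 s i)) /\
          ~ Qderives Q (Released (nth x1 s i))].

Definition relevant Q x : Prop :=
  exists n, [/\ Qderives Q (Activated x), Qderives Q (SentCount x n)
              & Qderives Q (RecvCount x n)].

Definition finalized Q : Prop :=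
  forall B x, B \in domf Q -> target x = B ->
    chain Q x -> owner x \in domf Q /\ relevant Q x.

Definition strongly_finalized Q : Prop :=
  forall B x, B \in domf Q -> target x = B ->
    Qderives Q (Unreleased x) -> relevant Q x.

End DRL.

(* Main.v *)
(* Along an execution, count for each refob x the messages sent and received
   along it. While x is active the counts in the actors' knowledge are these
   totals; Release x carries the final total, so x is only marked released once
   nothing is in transit along it. Hence every active refob to B is linked to a
   refob known to B by CreatedUsing facts and Info messages in transit, except
   when it comes from an external actor; but then B is a receptionist, and some
   refob to B owned by an external actor is so linked.

   If Q is finalized, no actor of Q receives an App or Info message after its
   snapshot. Indeed, by induction on time, consider a first such message,
   along w. Following the links to w (or to an externally owned refob) one
   finds a Chain in Q: each refob on the way is Relevant, so all messages along
   it recorded by its owner's snapshot had been received by B's snapshot, and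
   the next link is neither in transit nor changed between now and the owner's
   snapshot, be it past or future. So w is Relevant (and an externally owned
   refob is excluded, actors of Q being internal), which leaves no message in
   transit along w.

   Thus if Q contains CreatedUsing y x, then y is still active at the latest of
   the snapshots concerned, whence a Chain to y, which extends to x. *)

Require Import Defs.
From mathcomp Require Import all_boot finmap multiset zify.

Set Implicit Arguments.
Unset Strict Implicit.
Unset Printing Implicit Defensive.

Local Open Scope fset_scope.
Local Open Scope fmap_scope.
Local Open Scope nat_scope.

(** * Counting and membership in multisets *)

Section Multisets.
Variable T : choiceType.
Implicit Types (P : pred T) (mu : {mset T}%mset).

Lemma count_mset1D P m mu : count P (m +` mu)%mset = P m + count P mu.
Proof.
suff /permP -> : perm_eq (m +` mu)%mset (m :: mu) by [].
by apply/allP => a _ /=; rewrite !count_mem_mset mset1DE (eq_sym m).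
Qed.

Lemma count_msetB1 P m mu :
  m \in mu -> count P mu = P m + count P (mu `\ m)%mset.
Proof. by move=> mP; rewrite -count_mset1D msetB1K. Qed.

Lemma mem_msetB1 m m' mu : m' \in (mu `\ m)%mset -> m' \in mu.
Proof. by rewrite in_msetB1 => /andP[]. Qed.

Lemma mem_msetB1_neq m m' mu :
  m' != m -> m' \in mu -> m' \in (mu `\ m)%mset.
Proof. by rewrite in_msetB1 => /negPf -> ->. Qed.

Lemma count_mset_gt0 P m mu : m \in mu -> P m -> 0 < count P mu.
Proof. by move=> mP Pm; rewrite (count_msetB1 P mP) Pm. Qed.

End Multisets.

Lemma mem_zip_seq (S T : eqType) (s : seq S) (t : seq T) p :
  p \in zip s t -> p.1 \in s /\ p.2 \in t.
Proof.
elim: s t => [|a s IH] [|b t] //=; rewrite !inE => /predU1P[->|/IH[-> ->]].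
  by rewrite !eqxx.
by rewrite !orbT.
Qed.

Lemma mem_fset3 (T : choiceType) (a b c d : T) :
  (d \in [fset a; b; c]) = [|| d == a, d == b | d == c].
Proof. by rewrite !in_fsetU !in_fset1 orbA. Qed.

Lemma mem_fset_sieve (T : choiceType) (P : pred T) (S : {fset T}) (a b d : T) :
  (d \in [fset f in S `\ a `\ b | P f]) =
  [&& d != b, d != a, d \in S & P d].
Proof. by rewrite in_fset !inE -!andbA. Qed.

(** * Facts, derivability and count updates *)

Section Facts.
Variables Token Actor : choiceType.
Implicit Types (x y z w : refob Token Actor) (Phi Psi : kset Token Actor)
  (f g : fact Token Actor).

Lemma is_sentP x f : reflect (exists n, f = SentCount x n) (is_sent x f).
Proof.
apply: (iffP idP) => [|[n ->]]; last by rewrite /= eqxx.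
by case: f => //= y n /eqP ->; exists n.
Qed.

Lemma is_recvP x f : reflect (exists n, f = RecvCount x n) (is_recv x f).
Proof.
apply: (iffP idP) => [|[n ->]]; last by rewrite /= eqxx.
by case: f => //= y n /eqP ->; exists n.
Qed.

(* Comparing facts through their choice structure unfolds their encoding as
   trees; this comparison computes on the constructors instead. *)
Definition eq_fact f g :=
  match f, g with
  | Created x, Created y | Released x, Released y
  | Activated x, Activated y | Unreleased x, Unreleased y => x == y
  | CreatedUsing x x', CreatedUsing y y' => (x == y) && (x' == y')
  | SentCount x n, SentCount y m | RecvCount x n, RecvCount y m =>
      (x == y) && (n == m)
  | _, _ => false
  end.

Lemma fact_eqE f g : (f == g) = eq_fact f g.
Proof.
apply/eqP/idP => [<-|]; first by case: f => * /=; rewrite !eqxx.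
by case: f g => [x|x|x x'|x|x|x n|x n] [y|y|y y'|y|y|y m|y m] //=;
  (case/andP => /eqP-> /eqP->) || move=> /eqP->.
Qed.

Definition mem_factE :=
  (mem_fset3, mem_fset_sieve, in_fset1U, in_fsetD1, fact_eqE).

Lemma derives_activated Phi x :
  derives Phi (Activated x) -> Activated x \in Phi.
Proof. by inversion 1. Qed.

Lemma derives_using Phi x y :
  derives Phi (CreatedUsing x y) -> CreatedUsing x y \in Phi.
Proof. by inversion 1. Qed.

Lemma derives_released Phi x :
  derives Phi (Released x) -> Released x \in Phi.
Proof. by inversion 1. Qed.

Lemma derives_sentP Phi x n :
  derives Phi (SentCount x n) <->
  SentCount x n \in Phi \/ n = 0 /\ forall m, SentCount x m \notin Phi.
Proof.
split=> [H|[|[->]]]; [|exact: derives_mem|exact: derives_sent0].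
by inversion H; [left|right].
Qed.

Lemma derives_recvP Phi x n :
  derives Phi (RecvCount x n) <->
  RecvCount x n \in Phi \/ n = 0 /\ forall m, RecvCount x m \notin Phi.
Proof.
split=> [H|[|[->]]]; [|exact: derives_mem|exact: derives_recv0].
by inversion H; [left|right].
Qed.

Lemma derives_sent_eq Phi Psi x n :
  (forall m, (SentCount x m \in Psi) = (SentCount x m \in Phi)) ->
  derives Psi (SentCount x n) -> derives Phi (SentCount x n).
Proof.
move=> E /derives_sentP H; apply/derives_sentP; rewrite -E.
by case: H => [|[-> H]]; [left|right; split=> // m; rewrite -E].
Qed.

Lemma derives_recv_eq Phi Psi x n :
  (forall m, (RecvCount x m \in Psi) = (RecvCount x m \in Phi)) ->
  derives Psi (RecvCount x n) -> derives Phi (RecvCount x n).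
Proof.
move=> E /derives_recvP H; apply/derives_recvP; rewrite -E.
by case: H => [|[-> H]]; [left|right; split=> // m; rewrite -E].
Qed.

Lemma mem_inc_sent x f Phi :
  ~~ is_sent x f -> (f \in inc_sent x Phi) = (f \in Phi).
Proof.
move=> nf; rewrite /inc_sent; case: ifP => _.
  apply/imfsetP/idP => [[g /= gP]|fP]; last by exists f; rewrite // (negPf nf).
  case: ifP => [/is_sentP[n ->]|_ ->//] /= ef.
  by move: nf; rewrite ef /= eqxx.
rewrite in_fset1U; case: eqP => // ef.
by move: nf; rewrite ef /= eqxx.
Qed.

Lemma mem_inc_recv x f Phi :
  ~~ is_recv x f -> (f \in inc_recv x Phi) = (f \in Phi).
Proof.
move=> nf; rewrite /inc_recv; case: ifP => _.
  apply/imfsetP/idP => [[g /= gP]|fP]; last by exists f; rewrite // (negPf nf).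
  case: ifP => [/is_recvP[n ->]|_ ->//] /= ef.
  by move: nf; rewrite ef /= eqxx.
rewrite in_fset1U; case: eqP => // ef.
by move: nf; rewrite ef /= eqxx.
Qed.

(** The default value makes both branches of [inc_sent] alike: creating the count 1 increments the
    derivable 0. Uniqueness of count facts is not assumed: each count derivable afterwards comes
    from some count derivable before. *)
Lemma derives_inc_sent x n Phi :
  derives (inc_sent x Phi) (SentCount x n) ->
  exists2 m, n = m.+1 & derives Phi (SentCount x m).
Proof.
move=> /derives_sentP; rewrite /inc_sent; case: ifP => hasx.
  case=> [/imfsetP[g /= gP]|[_ none]].
    case: ifP => [/is_sentP[m eg]|ng eg].
      by rewrite eg => -[->]; exists m => //; apply: derives_mem; rewrite -eg.
    by rewrite -eg /= eqxx in ng.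
  have /hasP[g gP /is_sentP[m eg]] := hasx.
  have /negP[] := none m.+1; apply/imfsetP; exists g => //=.
  by rewrite eg /= eqxx.
case=> [|[_ /(_ 1)]]; last by rewrite in_fset1U eqxx.
have none m : SentCount x m \notin Phi.
  by apply/negP => mP; move/hasP: hasx; case; exists (SentCount x m) => //=.
rewrite in_fset1U (negPf (none n)) orbF => /eqP[->].
by exists 0 => //; apply: derives_sent0.
Qed.

Lemma derives_inc_recv x n Phi :
  derives (inc_recv x Phi) (RecvCount x n) ->
  exists2 m, n = m.+1 & derives Phi (RecvCount x m).
Proof.
move=> /derives_recvP; rewrite /inc_recv; case: ifP => hasx.
  case=> [/imfsetP[g /= gP]|[_ none]].
    case: ifP => [/is_recvP[m eg]|ng eg].
      by rewrite eg => -[->]; exists m => //; apply: derives_mem; rewrite -eg.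
    by rewrite -eg /= eqxx in ng.
  have /hasP[g gP /is_recvP[m eg]] := hasx.
  have /negP[] := none m.+1; apply/imfsetP; exists g => //=.
  by rewrite eg /= eqxx.
case=> [|[_ /(_ 1)]]; last by rewrite in_fset1U eqxx.
have none m : RecvCount x m \notin Phi.
  by apply/negP => mP; move/hasP: hasx; case; exists (RecvCount x m) => //=.
rewrite in_fset1U (negPf (none n)) orbF => /eqP[->].
by exists 0 => //; apply: derives_recv0.
Qed.

Lemma zip_new_refobs B (ys : seq (refob Token Actor)) ts :
  zip ys (new_refobs B ys ts) =
  [seq (p.1, Refob p.2 B (target p.1)) | p <- zip ys ts].
Proof. by elim: ys ts => [|y ys IH] [|t ts] //=; congr cons; exact: IH. Qed.

Lemma mem_zip_new_refobs B (ys : seq (refob Token Actor)) ts p :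
  p \in zip ys (new_refobs B ys ts) ->
  [/\ p.1 \in ys, p.2 \in new_refobs B ys ts, target p.2 = target p.1
    & token p.2 \in ts].
Proof.
rewrite zip_new_refobs => /mapP[q qz ->] /=; split=> //.
- by have [] := mem_zip_seq qz.
- by apply/mapP; exists q.
- by have [] := mem_zip_seq qz.
Qed.

Lemma mem_new_refobs B (ys : seq (refob Token Actor)) ts z :
  z \in new_refobs B ys ts ->
  owner z = B /\ exists y, (y, z) \in zip ys (new_refobs B ys ts).
Proof.
move=> /mapP[p pz ->]; split=> //; exists p.1.
by rewrite zip_new_refobs; apply/mapP; exists p.
Qed.

End Facts.

(** * Effect of a step on knowledge and messages *)

Ltac case_step st :=
  case: st =>
  [ alpha mu rho chi A' B' t u Phi x y HA ntu ft fu fB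
  | alpha mu rho chi A' x ys ts Phi zs HA ox actx actys szts uts fts
  | alpha mu rho chi B' x R Phi HB tx mB
  | alpha mu rho chi A' Phi HA
  | alpha mu rho chi A' y z Phi HA oy tz yz
  | alpha mu rho chi C' y z Phi HC tz mC
  | alpha mu rho chi A' x n' Phi HA ox actx sentx nox
  | alpha mu rho chi B' x n' Phi HB tx mB recvx
  | alpha mu rho chi C' x Phi HC tx crx relx
  | alpha mu rho chi A' Phi HA
  | alpha mu rho chi A' x R Arho tx ox fR injR Rrho
  | alpha mu rho chi B' x R Bchi tx mB
  | alpha mu rho chi B' x n' Bchi mB
  | alpha mu rho chi B' y z Bchi mB ].

Section Protocol.
Variables Token Actor : choiceType.
Local Notation refob := (refob Token Actor).
Local Notation kset := (kset Token Actor).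
Local Notation config := (config Token Actor).
Local Notation event := (event Token Actor).
Implicit Types (A B C : Actor) (x y z w : refob) (f : fact Token Actor)
  (Phi Psi : kset).
Implicit Types (h : seq config) (k : config) (e : event) (es : seq event).
Implicit Types (p : Actor * msg Token Actor)
  (alpha : {fmap Actor -> actor_state Token Actor}).

(* The empty knowledge set stands for the actors that are not internal. *)
Definition know (alpha : {fmap Actor -> actor_state Token Actor}) A : kset :=
  if alpha.[? A] is Some s then knowledge s else fset0.

Notation K k := (know (actors k)).

Lemma know_set alpha A B s :
  know alpha.[A <- s] B = if B == A then knowledge s else know alpha B.
Proof. by rewrite /know fnd_set; case: eqP. Qed.

Lemma know_some alpha A s : alpha.[? A] = Some s -> know alpha A = knowledge s.
Proof. by rewrite /know => ->. Qed.

Lemma know_notin alpha A : A \notin domf alpha -> know alpha A = fset0.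
Proof. by rewrite /know => /not_fnd ->. Qed.

Lemma mem_dom alpha A (s : actor_state Token Actor) :
  alpha.[? A] = Some s -> A \in domf alpha.
Proof. by move=> H; rewrite -fndSome H. Qed.

Lemma know_mem_dom alpha A f : f \in know alpha A -> A \in domf alpha.
Proof. by rewrite /know; case: fndP. Qed.

Lemma occurs_know k A f x :
  f \in K k A -> x \in fact_refobs f -> occurs_refob k x.
Proof.
rewrite /know; case EA: (_.[? A]) => [s|//] fs xf.
by left; exists A, s, f.
Qed.

(** Common form of freshness for refobs: a fresh token, a fresh owner or a fresh target each give
    it. *)
Definition unseen h x := forall k, List.In k h -> ~ occurs_refob k x.

Lemma fresh_token_unseen h x : fresh_token h (token x) -> unseen h x.
Proof. by move=> fr k kh /(fr _ _ kh). Qed.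

Lemma fresh_actor_owner h x : fresh_actor h (owner x) -> unseen h x.
Proof. by move=> fr k kh xk; apply: (fr k kh); constructor 4; exists x;
  auto. Qed.

Lemma fresh_actor_target h x : fresh_actor h (target x) -> unseen h x.
Proof. by move=> fr k kh xk; apply: (fr k kh); constructor 4; exists x;
  auto. Qed.

Lemma unseen_know h k A f x :
  unseen h x -> List.In k h -> x \in fact_refobs f -> (f \in K k A) = false.
Proof.
by move=> ux kh xf; apply/negP => fK; apply: (ux k kh);
  apply: occurs_know fK xf.
Qed.

Lemma unseen_msg h k p x :
  unseen h x -> List.In k h -> p \in undelivered k -> x \in msg_refobs p.2 ->
  False.
Proof.
by move=> ux kh pk xp; apply: (ux k kh); right; exists p.1, p.2;
  rewrite -surjective_pairing.
Qed.

Lemma fresh_actor_dom h k A :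
  fresh_actor h A -> List.In k h -> A \notin domf (actors k).
Proof. by move=> fr kh; apply/negP => Ak; apply: (fr k kh); constructor. Qed.

(** App and Info messages share the counts of the refob along which they travel. Messages entering
    from outside count as sends too, so that every later receipt is matched by a send. *)
Definition sends x e :=
  match e with ESend y _ _ | ESendInfo y _ | EIn y _ => y == x | _ => false end.
Definition recvs x e :=
  match e with EReceive y _ | EInfo y _ => y == x | _ => false end.
Definition drops x e := if e is ESendRelease y then y == x else false.
Definition frees x e := if e is ERelease y then y == x else false.

Definition along x p :=
  match p.2 with App y _ | Info y _ => y == x | Release _ _ => false end.
Definition carries z p := if p.2 is App _ R then z \in R else false.

Lemma step_dom h k e k' A :
  step h k e k' -> A \in domf (actors k) -> A \in domf (actors k').
Proof.
by move=> st; case_step st; rewrite //= ?inE => ->; rewrite ?orbT.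
Qed.

(** Only Spawn enlarges the domain. The last two clauses start the send counts of the new actor at
    0. *)
Lemma step_dom_back h k e k' A :
  step h k e k' -> A \in domf (actors k') ->
  A \in domf (actors k) \/
  [/\ fresh_actor h A, forall w, sends w e = false
    & forall w n, SentCount w n \notin K k' A].
Proof.
move=> st; case_step st; rewrite //= ?inE; try by left.
- case/or3P => [/eqP->|/eqP->|->]; last 1 first; try by left.
    by right; split=> // w n; rewrite know_set eqxx !mem_factE.
  by left; apply: mem_dom HA.
all: by case/predU1P => [->|]; left => //;
  first [exact: mem_dom HA | exact: mem_dom HB | exact: mem_dom HC].
Qed.

Lemma step_receptionists h k e k' A :
  step h k e k' -> A \in receptionists k -> A \in receptionists k'.
Proof. by move=> st; case_step st; rewrite //= ?inE => ->. Qed.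

(** Compaction is the only event that erases [Created w], and it requires [Released w]. Spawn
    overwrites the state of an actor, but a fresh one knows nothing. *)
Lemma step_created h k e k' A w :
  List.In k h -> step h k e k' -> Created w \in K k A ->
  Created w \in K k' A \/ Released w \in K k A.
Proof.
move=> + st; case_step st; move=> /= kh; rewrite ?know_set; try by left.
- have /know_notin/= BK := fresh_actor_dom fB kh.
  case: eqP => [->|_]; first by rewrite BK.
  by case: eqP => [->|_]; [rewrite (know_some HA) !mem_factE /= => ->;
    rewrite ?orbT|]; left.
- case: eqP => [->|_]; last by left.
  by rewrite (know_some HA) in_fsetU mem_inc_sent // => ->; left.
- case: eqP => [->|_]; last by left.
  by rewrite (know_some HB) in_fsetU mem_inc_recv // => ->; left.
- by case: eqP => [->|_]; [rewrite (know_some HA)|]; left.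
- case: eqP => [->|_]; last by left.
  by rewrite (know_some HA) mem_inc_sent // !mem_factE /= => ->; left.
- case: eqP => [->|_]; last by left.
  by rewrite (know_some HC) !mem_factE /= mem_inc_recv // => ->; rewrite ?orbT;
    left.
- case: eqP => [->|_]; last by left.
  by rewrite (know_some HA) !mem_factE /= => ->; left.
- case: eqP => [->|_]; last by left.
  by rewrite (know_some HB) !mem_factE /= => ->; left.
- case: eqP => [->|_]; last by left.
  rewrite (know_some HC) => wP; have [->|nwx] := eqVneq w x; first by right.
  by left; rewrite !mem_factE /= wP ?andbT; apply: contra_neq nwx => -[].
Qed.

Lemma step_using h k e k' A w w' :
  List.In k h -> step h k e k' -> CreatedUsing w w' \in K k A ->
  CreatedUsing w w' \in K k' A \/
  e = ESendInfo w w' /\ (target w, Info w w') \in undelivered k'.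
Proof.
move=> + st; case_step st; move=> /= kh; rewrite ?know_set; try by left.
- have /know_notin/= BK := fresh_actor_dom fB kh.
  case: eqP => [->|_]; first by rewrite BK.
  by case: eqP => [->|_]; [rewrite (know_some HA) !mem_factE /= => ->;
    rewrite ?orbT|]; left.
- case: eqP => [->|_]; last by left.
  by rewrite (know_some HA) in_fsetU mem_inc_sent // => ->; left.
- case: eqP => [->|_]; last by left.
  by rewrite (know_some HB) in_fsetU mem_inc_recv // => ->; left.
- by case: eqP => [->|_]; [rewrite (know_some HA)|]; left.
- case: eqP => [->|_]; last by left.
  rewrite (know_some HA) mem_inc_sent // => wP.
  have [[-> ->]|ne] := @eqP _ (CreatedUsing w w') (CreatedUsing y z).
    by right; split=> //; apply: mset1D1.
  by left; rewrite in_fsetD1 wP andbT; apply/eqP.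
- case: eqP => [->|_]; last by left.
  by rewrite (know_some HC) !mem_factE /= mem_inc_recv // => ->; left.
- case: eqP => [->|_]; last by left.
  by rewrite (know_some HA) !mem_factE /= => ->; left.
- case: eqP => [->|_]; last by left.
  by rewrite (know_some HB) !mem_factE /= => ->; left.
- case: eqP => [->|_]; last by left.
  by rewrite (know_some HC) !mem_factE /= => ->; left.
Qed.

Lemma step_using_back h k e k' A w w' :
  step h k e k' -> CreatedUsing w w' \in K k' A ->
  CreatedUsing w w' \in K k A \/
  [/\ exists ys zs x, e = ESend x ys zs, Activated w \in K k A, owner w = A,
      target w' = target w & unseen h w'].
Proof.
move=> st; case_step st; rewrite /= ?know_set; try by left.
- case: eqP => _; first by rewrite !mem_factE /=.
  by case: eqP => [->|_]; [rewrite (know_some HA) !mem_factE /=|]; left.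
- case: eqP => [->|_]; last by left.
  rewrite (know_some HA) in_fsetU mem_inc_sent // => /orP[|]; first by left.
  case/imfsetP => -[a b] /= /mem_zip_new_refobs[/= ay _ tb bt] [-> ->].
  have [oa acta] := actys _ ay.
  right; split=> //; [by exists ys, zs, x|exact: derives_activated|].
  exact/fresh_token_unseen/fts.
- case: eqP => [->|_]; last by left.
  rewrite (know_some HB) in_fsetU mem_inc_recv // => /orP[|]; first by left.
  by case/imfsetP.
- by case: eqP => [->|_]; [rewrite (know_some HA)|]; left.
- case: eqP => [->|_]; last by left.
  by rewrite (know_some HA) mem_inc_sent // !mem_factE /= => /andP[_]; left.
- case: eqP => [->|_]; last by left.
  by rewrite (know_some HC) !mem_factE /= mem_inc_recv //=; left.
- case: eqP => [->|_]; last by left.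
  by rewrite (know_some HA) !mem_factE /=; left.
- case: eqP => [->|_]; last by left.
  by rewrite (know_some HB) !mem_factE /=; left.
- case: eqP => [->|_]; last by left.
  by rewrite (know_some HC) !mem_factE /= andbT; left.
Qed.

Lemma step_activated h k e k' A w :
  List.In k h -> step h k e k' -> Activated w \in K k A ->
  Activated w \in K k' A \/
  [/\ e = ESendRelease w, owner w = A & forall y,
    CreatedUsing w y \notin K k A].
Proof.
move=> + st; case_step st; move=> /= kh; rewrite ?know_set; try by left.
- have /know_notin/= BK := fresh_actor_dom fB kh.
  case: eqP => [->|_]; first by rewrite BK.
  by case: eqP => [->|_]; [rewrite (know_some HA) !mem_factE /= => ->;
    rewrite ?orbT|]; left.
- case: eqP => [->|_]; last by left.
  by rewrite (know_some HA) in_fsetU mem_inc_sent // => ->; left.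
- case: eqP => [->|_]; last by left.
  by rewrite (know_some HB) in_fsetU mem_inc_recv // => ->; left.
- by case: eqP => [->|_]; [rewrite (know_some HA)|]; left.
- case: eqP => [->|_]; last by left.
  by rewrite (know_some HA) mem_inc_sent // !mem_factE /= => ->; left.
- case: eqP => [->|_]; last by left.
  by rewrite (know_some HC) !mem_factE /= mem_inc_recv // => ->; left.
- case: eqP => [->|_]; last by left.
  rewrite (know_some HA) => wP; have [->|nwx] := eqVneq w x; first by right.
  by left; rewrite !mem_factE /= wP ?andbT; apply: contra_neq nwx => -[].
- case: eqP => [->|_]; last by left.
  by rewrite (know_some HB) !mem_factE /= => ->; left.
- case: eqP => [->|_]; last by left.
  by rewrite (know_some HC) !mem_factE /= => ->; left.
Qed.

(** The second case is Spawn, whose refobs the child knows as created from the start. In the third,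
    the equation on messages lets a unit of [carries w] be traded for the activation. *)
Lemma step_activated_back h k e k' A w :
  step h k e k' -> Activated w \in K k' A ->
  [\/ Activated w \in K k A,
      [/\ unseen h w, undelivered k' = undelivered k
        & Created w \in K k' (target w)]
    | exists x R, [/\ e = EReceive x R, w \in R
                    & undelivered k = ((A, App x R) +` undelivered k')%mset]].
Proof.
move=> st; case_step st; rewrite /= ?know_set; try by move=> ?; constructor 1.
- have unx : unseen h x by exact: fresh_token_unseen.
  have uny : unseen h y by exact: fresh_token_unseen.
  case: eqP => [->|nAB].
    rewrite !mem_factE /= => /eqP[->]; constructor 2; split=> //=.
    by rewrite eqxx !mem_factE /= eqxx orbT.
  case: eqP => [->|_]; last by constructor 1.
  rewrite (know_some HA) !mem_factE /= => /predU1P[[->]|];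
    last by constructor 1.
  by constructor 2; split=> //=; rewrite eqxx !mem_factE /= eqxx.
- case: eqP => [->|_]; last by constructor 1.
  rewrite (know_some HA) in_fsetU mem_inc_sent // => /orP[|];
    first by constructor 1.
  by case/imfsetP.
- case: eqP => [->|_]; last by constructor 1.
  rewrite (know_some HB) in_fsetU mem_inc_recv // => /orP[|];
    first by constructor 1.
  by case/imfsetP => z /= zR [->]; constructor 3; exists x, R; rewrite msetB1K.
- by case: eqP => [->|_]; [rewrite (know_some HA)|]; constructor 1.
- case: eqP => [->|_]; last by constructor 1.
  by rewrite (know_some HA) mem_inc_sent // !mem_factE /=; constructor 1.
- case: eqP => [->|_]; last by constructor 1.
  by rewrite (know_some HC) !mem_factE /= mem_inc_recv //=; constructor 1.
- case: eqP => [->|_]; last by constructor 1.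
  by rewrite (know_some HA) !mem_factE /= => /andP[_]; constructor 1.
- case: eqP => [->|_]; last by constructor 1.
  by rewrite (know_some HB) !mem_factE /=; constructor 1.
- case: eqP => [->|_]; last by constructor 1.
  by rewrite (know_some HC) !mem_factE /= andbT; constructor 1.
Qed.

Lemma step_released_back h k e k' A w :
  step h k e k' -> Released w \in K k' A -> Released w \in K k A \/ frees w e.
Proof.
move=> st; case_step st; rewrite /= ?know_set; try by move=> ?; left.
- case: eqP => _; first by rewrite !mem_factE /=.
  by case: eqP => [->|_]; [rewrite (know_some HA) !mem_factE /=|]; left.
- case: eqP => [->|_]; last by left.
  rewrite (know_some HA) in_fsetU mem_inc_sent // => /orP[|]; first by left.
  by case/imfsetP.
- case: eqP => [->|_]; last by left.
  rewrite (know_some HB) in_fsetU mem_inc_recv // => /orP[|]; first by left.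
  by case/imfsetP.
- by case: eqP => [->|_]; [rewrite (know_some HA)|]; left.
- case: eqP => [->|_]; last by left.
  by rewrite (know_some HA) mem_inc_sent // !mem_factE /=; left.
- case: eqP => [->|_]; last by left.
  by rewrite (know_some HC) !mem_factE /= mem_inc_recv //=; left.
- case: eqP => [->|_]; last by left.
  by rewrite (know_some HA) !mem_factE /=; left.
- case: eqP => [->|_]; last by left.
  rewrite (know_some HB) !mem_factE /= => /predU1P[[->]|]; last by left.
  by right; apply: eqxx.
- case: eqP => [->|_]; last by left.
  by rewrite (know_some HC) !mem_factE /= andbT => /andP[_]; left.
Qed.

Lemma step_drops h k e k' w :
  step h k e k' -> drops w e ->
  [/\ Activated w \in K k (owner w), owner w \in domf (actors k),
      Activated w \notin K k' (owner w),
      forall y, CreatedUsing w y \notin K k (owner w)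
    & exists2 n, undelivered k' =
        ((target w, Release w n) +` undelivered k)%mset
        & derives (K k (owner w)) (SentCount w n)].
Proof.
move=> st; case_step st => //= /eqP <-.
rewrite ox know_set eqxx (know_some HA) /=; split=> //.
- exact: mem_dom HA.
- by rewrite !mem_factE /= eqxx.
- by exists n'.
Qed.

Lemma step_frees h k e k' w :
  step h k e k' -> frees w e ->
  exists n, (target w, Release w n) \in undelivered k /\
            derives (K k (target w)) (RecvCount w n).
Proof.
by move=> st; case_step st => //= /eqP <-; exists n'; rewrite tx (know_some HB).
Qed.

(* An external owner may send along any refob: no knowledge backs such sends. *)
Lemma step_sends h k e k' w :
  step h k e k' -> sends w e ->
  Activated w \in K k (owner w) \/
  (exists z, CreatedUsing w z \in K k (owner w)) \/
  owner w \notin domf (actors k) /\ target w \in receptionists k.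
Proof.
move=> st; case_step st => //= /eqP <-.
- by left; rewrite ox (know_some HA); apply: derives_activated.
- by right; left; exists z; rewrite oy (know_some HA).
- by right; right; rewrite tx.
Qed.

(** Only an inequality holds: [EOut] and [EInfoOut] remove messages without counting as receipts. *)
Lemma step_count_along h k e k' w :
  step h k e k' ->
  recvs w e + count (along w) (undelivered k') <=
  sends w e + count (along w) (undelivered k).
Proof.
move=> st; case_step st; rewrite /= ?count_mset1D ?add0n //=.
- by rewrite [leqRHS](count_msetB1 _ mB).
- by rewrite [leqRHS](count_msetB1 _ mC).
all: by rewrite [leqRHS](count_msetB1 (along w) mB) leq_addl.
Qed.

(** Both side conditions exclude a mismatch between knowledge and events: SendRelease erases the
    stored count, and sends by an external owner are not stored anywhere. *)
Lemma step_sent_count h k e k' w n :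
  List.In k h -> step h k e k' -> owner w \in domf (actors k) -> ~~ drops w e ->
  derives (K k' (owner w)) (SentCount w n) ->
  exists2 m, n = sends w e + m & derives (K k (owner w)) (SentCount w m).
Proof.
have same Phi Psi : (forall m, (SentCount w m \in Psi) = (SentCount w m \in
  Phi)) ->
    derives Psi (SentCount w n) ->
    exists2 m, n = false + m & derives Phi (SentCount w m).
  by move=> E d; exists n => //; apply: derives_sent_eq d.
move=> + st; case_step st => /= kh; rewrite ?know_set => ow nd.
- have /negP/= nB := fresh_actor_dom fB kh.
  case: eqP => [eB|_]; first by rewrite eB in ow.
  case: eqP => [->|_]; apply: same => // m.
  by rewrite (know_some HA) !mem_factE.
- have [oA|nA] := eqVneq (owner w) A'; last first.
    have /negPf -> : x != w by apply: contraNneq nA => <-; rewrite ox.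
    exact: same.
  rewrite oA (know_some HA) /=.
  have E m : (SentCount w m \in inc_sent x Phi `|` [fset CreatedUsing p.1 p.2 |
    p in zip ys zs]) =
      (SentCount w m \in inc_sent x Phi).
    by rewrite in_fsetU; case: imfsetP => [[? _ //]|_]; rewrite orbF.
  move=> /(derives_sent_eq E) {E}; have [->|nxw] := eqVneq x w.
    by move=> /derives_inc_sent[m -> dm]; exists m.
  by apply: same => m; rewrite mem_inc_sent //= eq_sym.
- case: eqP => [->|_]; apply: same => // m.
  rewrite in_fsetU mem_inc_recv // (know_some HB).
  by case: imfsetP => [[? _ //]|_]; rewrite orbF.
- by case: eqP => [->|_]; apply: same => // m; rewrite (know_some HA).
- have [oA|nA] := eqVneq (owner w) A'; last first.
    have /negPf -> : y != w by apply: contraNneq nA => <-; rewrite oy.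
    exact: same.
  rewrite oA (know_some HA) /=; have [->|nyw] := eqVneq y w.
    move=> /derives_inc_sent[m -> dm]; exists m => //.
    by apply: derives_sent_eq dm => q; rewrite !mem_factE.
  by apply: same => m; rewrite mem_inc_sent ?mem_factE //= eq_sym.
- case: eqP => [->|_]; apply: same => // m.
  by rewrite !mem_factE /= mem_inc_recv // (know_some HC).
- case: eqP => [->|_]; apply: same => // m.
  by rewrite !mem_factE /= (know_some HA) eq_sym (negPf nd).
- by case: eqP => [->|_]; apply: same => // m;
    rewrite (know_some HB) !mem_factE.
- case: eqP => [->|_]; apply: same => // m.
  by rewrite (know_some HC) !mem_factE /= andbT.
- exact: same.
- by case: eqP => [xw|_]; [rewrite -xw (negPf ox) in ow|apply: same].
- exact: same.
- exact: same.
- exact: same.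
Qed.

(** The rule for Info constrains only the target of [z]; the first hypothesis ensures that the count
    is incremented at the target of [y]. Excluding [Released w] rules out a Compaction that erases
    the count. *)
Lemma step_recv_count h k e k' w n :
  (forall C y z, (C, Info y z) \in undelivered k -> target y = C) ->
  List.In k h -> step h k e k' -> Released w \notin K k (target w) ->
  derives (K k' (target w)) (RecvCount w n) ->
  exists2 m, n = recvs w e + m & derives (K k (target w)) (RecvCount w m).
Proof.
have same Phi Psi : (forall m, (RecvCount w m \in Psi) = (RecvCount w m \in
  Phi)) ->
    derives Psi (RecvCount w n) ->
    exists2 m, n = false + m & derives Phi (RecvCount w m).
  by move=> E d; exists n => //; apply: derives_recv_eq d.
move=> + + st; case_step st => /= infoP kh; rewrite ?know_set => nr.
- have /know_notin/= nB := fresh_actor_dom fB kh.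
  case: eqP => [->|_]; first by apply: same => m; rewrite nB !mem_factE.
  case: eqP => [->|_]; apply: same => // m.
  by rewrite (know_some HA) !mem_factE.
- case: eqP => [->|_]; apply: same => // m.
  rewrite in_fsetU mem_inc_sent // (know_some HA).
  by case: imfsetP => [[? _ //]|_]; rewrite orbF.
- have [tB|nB] := eqVneq (target w) B'; last first.
    have /negPf -> : x != w by apply: contraNneq nB => <-; rewrite tx.
    exact: same.
  rewrite tB (know_some HB) /=.
  have E m : (RecvCount w m \in inc_recv x Phi `|` [fset Activated z | z in R])
    =
      (RecvCount w m \in inc_recv x Phi).
    by rewrite in_fsetU; case: imfsetP => [[? _ //]|_]; rewrite orbF.
  move=> /(derives_recv_eq E) {E}; have [->|nxw] := eqVneq x w.
    by move=> /derives_inc_recv[m -> dm]; exists m.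
  by apply: same => m; rewrite mem_inc_recv //= eq_sym.
- by case: eqP => [->|_]; apply: same => // m; rewrite (know_some HA).
- case: eqP => [->|_]; apply: same => // m.
  by rewrite mem_inc_sent ?mem_factE // (know_some HA).
- have [tC|nC] := eqVneq (target w) C'; last first.
    have /negPf -> : y != w by apply: contraNneq nC => <-;
      rewrite (infoP _ _ _ mC).
    case: eqP nC => // _ _; exact: same.
  rewrite tC (know_some HC) /=.
  have E m : (RecvCount w m \in Created z |` inc_recv y Phi) =
      (RecvCount w m \in inc_recv y Phi).
    by rewrite !mem_factE.
  move=> /(derives_recv_eq E) {E}; have [->|nxw] := eqVneq y w.
    by move=> /derives_inc_recv[m -> dm]; exists m.
  by apply: same => m; rewrite mem_inc_recv //= eq_sym.
- case: eqP => [->|_]; apply: same => // m.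
  by rewrite !mem_factE /= (know_some HA).
- by case: eqP => [->|_]; apply: same => // m;
    rewrite (know_some HB) !mem_factE.
- have [tC|nC] := eqVneq (target w) C'; last exact: same.
  (* Compaction of [w] itself would need [Released w], which [nr] forbids; compaction of another
     refob keeps the count. *)
  apply: same => m; rewrite tC (know_some HC) !mem_factE /=.
  rewrite [w == x]eq_sym; case: eqVneq nr => [<-|_ _]; last by rewrite andbT.
  by rewrite tx (know_some HC) relx.
all: exact: same.
Qed.

Lemma step_release_back h k e k' B w n :
  step h k e k' -> (B, Release w n) \in undelivered k' ->
  (B, Release w n) \in undelivered k \/
  drops w e /\ derives (K k (owner w)) (SentCount w n).
Proof.
move=> st; case_step st => //=; try by left.
all: try by move=> /mem_msetB1; left.
all: rewrite in_mset1D => /orP[/eqP|]; last by left.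
all: try discriminate.
by case=> _ -> ->; right; rewrite eqxx ox (know_some HA).
Qed.

Lemma step_app_back h k e k' B w S :
  step h k e k' -> (B, App w S) \in undelivered k' ->
  (B, App w S) \in undelivered k \/ forall v, v \in S -> owner v = B.
Proof.
move=> st; case_step st => //=; try by left.
all: try by move=> /mem_msetB1; left.
all: rewrite in_mset1D => /orP[/eqP|]; last by left.
all: try discriminate.
- by case=> -> _ ->; right=> v; rewrite in_fset => /mem_new_refobs[].
- by case=> -> _ ->; right=> v /fR[].
Qed.

Lemma step_info_back h k e k' C w w' :
  step h k e k' -> (C, Info w w') \in undelivered k' ->
  (C, Info w w') \in undelivered k \/ target w = C.
Proof.
move=> st; case_step st => //=; try by left.
all: try by move=> /mem_msetB1; left.
all: rewrite in_mset1D => /orP[/eqP|]; last by left.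
all: try discriminate.
by case=> -> -> _; right.
Qed.

Lemma step_info h k e k' C w w' :
  step h k e k' -> (C, Info w w') \in undelivered k -> C \notin externals k ->
  (C, Info w w') \in undelivered k' \/ Created w' \in K k' C.
Proof.
move=> st; case_step st => //= wP Cext; try by left.
all: try by left; apply: mset1Dr.
all: try by left; apply: mem_msetB1_neq wP; apply/eqP; discriminate.
- have [[-> _ ->]|ne] := @eqP _ (C, Info w w') (C', Info y z).
    by right; rewrite know_set eqxx fset1U1.
  by left; apply: mem_msetB1_neq wP; apply/eqP.
- left; apply: mem_msetB1_neq wP; apply/eqP => -[eC _ _].
  by rewrite eC Bchi in Cext.
Qed.

Lemma step_externals h k e k' A :
  step h k e k' -> A \in externals k' ->
  A \in externals k \/ A \notin domf (actors k').
Proof.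
move=> st; case_step st => //=; try by left.
rewrite in_fsetU => /orP[|]; first by left.
by case/imfsetP => z /=; rewrite !inE => /andP[_ nz] ->; right.
Qed.

Lemma step_receptionists_back h k e k' B :
  step h k e k' -> B \in receptionists k' ->
  B \in receptionists k \/
  exists C x R z, [/\ C \in externals k, (C, App x R) \in undelivered k,
                      z \in R, target z = B & B \in domf (actors k)].
Proof.
move=> st; case_step st => //=; try by left.
rewrite in_fsetU => /orP[|]; first by left.
case/imfsetP => z /=; rewrite !inE => /andP[zR dz] ->; right.
by exists B', x, R, z.
Qed.

(** The trace left by creating [w'] from [w]: still recorded by the owner of [w], or on its way to
    the target. *)
Definition link k w w' :=
  CreatedUsing w w' \in K k (owner w) \/
  (target w, Info w w') \in undelivered k.

(** Only Send and In put new refobs into messages, and their tokens are fresh. Send leaves a link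
    from an active refob with the same target; In only guarantees that an internal target is a
    receptionist. *)
Lemma step_carries h k e k' w :
  List.In k h -> step h k e k' ->
  count (carries w) (undelivered k') <= count (carries w) (undelivered k) \/
  [/\ unseen h w, count (carries w) (undelivered k') <= 1
    & (exists y, [/\ link k' y w, target w = target y
                   & Activated y \in K k (owner y)]) \/
      (target w \in domf (actors k') -> target w \in receptionists k')].
Proof.
have none kk : unseen h w -> List.In kk h ->
    count (carries w) (undelivered kk) = 0.
  move=> uw kh; apply/eqP; rewrite -leqn0 leqNgt -has_count.
  apply/negP => /hasP[[B m] mP /=]; rewrite /carries /=.
  case: m mP => //= x R mP wR; apply: (unseen_msg uw kh mP).
  by rewrite /= inE wR orbT.
move=> + st; case_step st => //= kh; try by left.
all: try by left; rewrite count_mset1D.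
all: try by left; rewrite [leqRHS](count_msetB1 (carries w) mB) leq_addl.
all: try by left; rewrite [leqRHS](count_msetB1 (carries w) mC) leq_addl.
- rewrite count_mset1D /carries /= in_fset.
  have [wz|_] := boolP (w \in zs); last by left.
  have [ow [y yw]] := mem_new_refobs wz.
  have [/= yys _ tw tok] := mem_zip_new_refobs yw.
  have uw : unseen h w by apply/fresh_token_unseen/fts.
  right; split=> //; first by rewrite (none _ uw kh).
  have [oy acty] := actys _ yys.
  left; exists y; split=> //.
    left; rewrite /= oy know_set eqxx /= in_fsetU; apply/orP; right.
    by apply/imfsetP; exists (y, w).
  by rewrite oy (know_some HA); apply: derives_activated.
- rewrite count_mset1D /carries /=.
  have [wR|_] := boolP (w \in R); last by left.
  have uw : unseen h w by apply/fresh_token_unseen; case: (fR _ wR).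
  by right; split=> //; [rewrite (none _ uw kh)|right; apply: Rrho].
Qed.

Definition mentions x e := [|| sends x e, recvs x e, drops x e | frees x e].

(** The second alternative serves [EIn], whose refob may not occur before the step. *)
Lemma step_mentions h k e k' w :
  step h k e k' -> mentions w e -> occurs_refob k w \/ occurs_refob k' w.
Proof.
move=> st; case_step st; rewrite /mentions //= ?orbF => /eqP ?; subst w.
- left; apply: (occurs_know (A := A') (f := Activated x)); last by rewrite inE.
  by rewrite (know_some HA); apply: derives_activated.
- by left; right; exists B', (App x R); rewrite mem_head.
- left; apply: (occurs_know (A := A') (f := CreatedUsing y z)).
    by rewrite (know_some HA).
  by rewrite inE eqxx.
- by left; right; exists C', (Info y z); rewrite mem_head.
- left; apply: (occurs_know (A := A') (f := Activated x)); last by rewrite inE.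
  by rewrite (know_some HA).
- by left; right; exists B', (Release x n'); rewrite mem_head.
- by right; right; exists A', (App x R); rewrite mset1D1 mem_head.
Qed.

(** * Message counts along an execution *)

Lemma In_rcons (T : Type) (s : seq T) a b :
  List.In a (rcons s b) <-> List.In a s \/ a = b.
Proof. by elim: s => [|c s IH] /=; [|rewrite IH]; intuition. Qed.

(* es lists the events and h the configurations up to k, the current one. *)
Record consistent h es k : Prop := Consistent {
  inv_in : List.In k h;
  inv_seen : forall w, has (mentions w) es ->
    exists2 k', List.In k' h & occurs_refob k' w;
  inv_ext : forall A, A \in externals k -> A \notin domf (actors k);
  inv_rec : forall A, A \in receptionists k -> A \in domf (actors k);
  inv_app : forall B x R, (B, App x R) \in undelivered k ->
    forall z, z \in R -> owner z = B;
  inv_info : forall C y z, (C, Info y z) \in undelivered k -> target y = C;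
  inv_using : forall A y z, CreatedUsing y z \in K k A ->
    [/\ owner y = A, target z = target y & Activated y \in K k A];
  inv_unique : forall w,
    count (carries w) (undelivered k) + (Activated w \in K k (owner w)) +
    count (drops w) es <= 1;
  inv_drops : forall w, 0 < count (drops w) es -> owner w \in domf (actors k);
  inv_sent : forall w n, count (drops w) es = 0 ->
    owner w \in domf (actors k) -> derives (K k (owner w)) (SentCount w n) ->
    n = count (sends w) es;
  inv_released : forall A w, Released w \in K k A -> has (frees w) es;
  inv_recv : forall w n, ~~ has (frees w) es ->
    derives (K k (target w)) (RecvCount w n) -> n = count (recvs w) es;
  inv_along : forall w, count (recvs w) es + count (along w) (undelivered k) <=
    count (sends w) es;
  inv_release : forall B w n, (B, Release w n) \in undelivered k ->
    0 < count (drops w) es /\ n = count (sends w) es;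
  inv_freed : forall w, has (frees w) es ->
    0 < count (drops w) es /\ count (sends w) es <= count (recvs w) es
}.

Lemma count_rcons (T : Type) (P : pred T) s a :
  count P (rcons s a) = P a + count P s.
Proof. by rewrite -cats1 count_cat /= addn0 addnC. Qed.

Lemma sub_count0 (T : Type) (P P' : pred T) s :
  subpred P P' -> ~~ has P' s -> count P s = 0.
Proof. by move=> sub; rewrite has_count; have := sub_count sub s; lia. Qed.

(** * Consequences of the counting invariant *)

Section Consequences.
Variables (h : seq config) (es : seq event) (k : config).
Hypothesis I : consistent h es k.

Lemma unseen_mentions w : unseen h w -> ~~ has (mentions w) es.
Proof. by move=> uw; apply/negP => /(inv_seen I)[k' /uw]. Qed.

Lemma unseen_sends w : unseen h w -> count (sends w) es = 0.
Proof.
by move=> /unseen_mentions; apply: sub_count0 => e; rewrite /mentions => ->.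
Qed.

Lemma unseen_drops w : unseen h w -> count (drops w) es = 0.
Proof.
by move=> /unseen_mentions; apply: sub_count0 => e; rewrite /mentions => ->;
  rewrite !orbT.
Qed.

Lemma unseen_carries w : unseen h w -> count (carries w) (undelivered k) = 0.
Proof.
move=> uw; apply/eqP; rewrite -leqn0 leqNgt -has_count.
apply/negP => /hasP[[B m] mP /=]; rewrite /carries /=.
case: m mP => //= x R mP wR; apply: (unseen_msg uw (inv_in I) mP).
by rewrite /= inE wR orbT.
Qed.

Lemma activated_drops w :
  Activated w \in K k (owner w) -> count (drops w) es = 0.
Proof. by move=> a; have := inv_unique I w; rewrite a; lia. Qed.

Lemma not_freed_of_drops w : count (drops w) es = 0 -> ~~ has (frees w) es.
Proof. by move=> d; apply/negP => /(inv_freed I)[]; rewrite d. Qed.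

(** A recorded creation keeps [w] active, so [w] was never dropped. An Info message in transit makes
    the sends along [w] exceed the receipts, whereas freeing requires all of them received. *)
Lemma link_not_freed w w' : link k w w' -> ~~ has (frees w) es.
Proof.
case=> [/(inv_using I)[_ _ /activated_drops]|wP];
  first exact: not_freed_of_drops.
apply/negP => /(inv_freed I)[_ sr].
have : 0 < count (along w) (undelivered k).
  by apply: count_mset_gt0 wP _; rewrite /along /= eqxx.
by have := inv_along I w; lia.
Qed.

(* A refob in one of these states, if owned by an internal actor, has not been
   released by it or still has undelivered messages: it cannot be freed. *)
Definition live w :=
  [\/ Activated w \in K k (owner w), 0 < count (carries w) (undelivered k)
    | 0 < count (along w) (undelivered k)].

Lemma live_not_freed w : live w -> ~~ has (frees w) es.
Proof.
case=> [/activated_drops|c|a]; first exact: not_freed_of_drops.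
  by apply: not_freed_of_drops; have := inv_unique I w; lia.
by apply/negP => /(inv_freed I)[_]; have := inv_along I w; lia.
Qed.

(** Sending along [w] requires it to be active or its owner to be external. A drop is made by an
    internal owner and uses up the only activation. *)
Lemma dropped_no_sends e k' w :
  step h k e k' -> 0 < count (drops w) es -> sends w e = false.
Proof.
move=> st d; apply/negP => /(step_sends st)[|[[z]|[]]].
- by move=> /activated_drops d0; rewrite d0 in d.
- by move=> /(inv_using I)[_ _ /activated_drops d0]; rewrite d0 in d.
- by rewrite (inv_drops I d).
Qed.

Lemma live_occurs w : live w -> occurs_refob k w.
Proof.
case=> [a|c|a]; first by apply: occurs_know a _; rewrite inE.
- move: c; rewrite -has_count => /hasP[[B m] mP]; rewrite /carries /= => c.
  right; exists B, m; split=> //.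
  by case: m c {mP} => //= x R wR; rewrite inE wR orbT.
- move: a; rewrite -has_count => /hasP[[B m] mP]; rewrite /along /= => a.
  right; exists B, m; split=> //.
  by case: m a {mP} => //= [x R|x z] /eqP->; rewrite mem_head.
Qed.

End Consequences.

Lemma consistent_step h es k e k' :
  consistent h es k -> step h k e k' -> consistent (rcons h k') (rcons es e) k'.
Proof.
move=> I st; have kh := inv_in I.
have isdrop_nosend w : drops w e -> sends w e = false by case: (e).
split.
- by apply/In_rcons; right.
- move=> w; rewrite has_rcons => /orP[|].
    by case/(step_mentions st) => o; [exists k|exists k']; rewrite ?In_rcons;
      auto.
  by case/(inv_seen I) => k0 k0h; exists k0; rewrite ?In_rcons; auto.
- move=> A /(step_externals st)[|//] Aext.
  have nA := inv_ext I Aext.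
  apply/negP => /(step_dom_back st)[|[fA _ _]]; first exact/negP.
  by apply: (fA k kh); constructor 2.
- move=> A /(step_receptionists_back st)[/(inv_rec I)|[C [x [R [z []]]]] *];
  exact: (step_dom st).
- by move=> B x R /(step_app_back st)[|//]; apply: (inv_app I).
- by move=> C y z /(step_info_back st)[|//]; apply: (inv_info I).
- move=> A y z /(step_using_back st)[yz|[[ys [zs [x ee]]] act oy tz _]].
    have [oy tz act] := inv_using I yz; split=> //.
    (* SendRelease of [y] is blocked as long as [CreatedUsing y z] is held. *)
    by case: (step_activated kh st act) => // -[_ _ /(_ z)]; rewrite yz.
  by split=> //; case: (step_activated kh st act) => //; rewrite ee => -[].
(* Each refob owns a single unit, introduced while it is unseen: Receive moves it from a message to
   an activation, and SendRelease from the activation to a drop. *)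
- move=> w; have := inv_unique I w; rewrite count_rcons.
  have dropE : drops w e -> Activated w \in K k (owner w).
    by case/(step_drops st).
  have [act'|_] := boolP (_ \in K k' _).
    have [act|[uw -> _]|[x [R [ee wR ->]]]] := step_activated_back st act'.
    + have -> : drops w e = false.
        by apply/negP => /(step_drops st)[_ _]; rewrite act'.
      rewrite act; case: (step_carries w kh st) => [le|[uw _ _]].
        by lia.
      by rewrite (unseen_know _ uw kh) ?inE in act.
    + rewrite (unseen_carries I uw) (unseen_drops I uw).
      suff -> : drops w e = false by [].
      by apply/negP => /dropE; rewrite (unseen_know _ uw kh) ?inE.
    + by rewrite ee count_mset1D {1}/carries /= wR; lia.
  have [d|nd] := boolP (drops w e).
    rewrite (dropE d); case: (step_carries w kh st) => [le|[uw _ _]].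
      by lia.
    by move: (dropE d); rewrite (unseen_know _ uw kh) ?inE.
  case: (step_carries w kh st) => [|[uw]]; first by lia.
  by rewrite (unseen_drops I uw); lia.
- move=> w; rewrite count_rcons.
  case: (boolP (drops w e)) => [/(step_drops st)[_ o _ _ _] _|_].
    exact: step_dom st o.
  by rewrite add0n => /(inv_drops I); apply: step_dom st.
- move=> w n; rewrite !count_rcons => /eqP; rewrite addn_eq0 eqb0.
  case/andP => nd /eqP d0 /(step_dom_back st)[o|[fo ns none]].
    case/(step_sent_count kh st o nd) => m -> dm.
    by rewrite (inv_sent I d0 o dm).
  move=> /derives_sentP[|[-> _]]; first by rewrite (negPf (none _ _)).
  by rewrite ns (unseen_sends I) //; apply: fresh_actor_owner.
- move=> A w; rewrite has_rcons => /(step_released_back st)[/(inv_released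
    I)->|->//].
  by rewrite orbT.
- move=> w n; rewrite has_rcons count_rcons negb_or => /andP[_ nf].
  have nr : Released w \notin K k (target w).
    by apply: contra nf; apply: (inv_released I).
  by case/(step_recv_count (inv_info I) kh st nr) => m -> /(inv_recv I nf) ->.
- move=> w; rewrite !count_rcons.
  by have := step_count_along w st; have := inv_along I w; lia.
- move=> B w n; rewrite !count_rcons => /(step_release_back st)[].
    move=> /(inv_release I)[d ->]; split; first by rewrite addn_gt0 d orbT.
    by rewrite (dropped_no_sends I st d).
  case=> d dn; rewrite d isdrop_nosend //; split=> //.
  have [act o _ _ _] := step_drops st d.
  exact: (inv_sent I (activated_drops I act) o dn).
(* The guard of Release equates the receive count with the [n] of the message, the total of sends.
   No send follows a drop, so the inequality persists. *)
- move=> w; rewrite has_rcons !count_rcons => /orP[fr|/(inv_freed I)[d sr]].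
    have [n [nP dn]] := step_frees st fr.
    have [d en] := inv_release I nP.
    rewrite (dropped_no_sends I st d) addn_gt0 d orbT; split=> //.
    rewrite add0n -en; apply: leq_trans (leq_addl _ _).
    (* If [w] was already freed, its stored count may have been erased; the earlier inequality is
       used instead. *)
    case: (boolP (has (frees w) es)) => [/(inv_freed I)[_]|/(inv_recv I)/(_ dn)
      -> //].
    by rewrite -en.
  rewrite (dropped_no_sends I st d) addn_gt0 d orbT; split=> //.
  by apply: leq_trans sr _; apply: leq_addl.
Qed.

(** * Chains of links in a configuration *)

(** Counterpart of [chain] in a configuration: Info messages in transit also serve as links, and
    release is read off the past events because Compaction erases [Released] facts. *)
Inductive rooted es k : refob -> Prop :=
| rooted_created w :
    Created w \in K k (target w) -> ~~ has (frees w) es -> rooted es k w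
| rooted_link w w' :
    rooted es k w -> target w' = target w -> link k w w' ->
    ~~ has (frees w') es -> rooted es k w'.

Lemma link_occurs k w w' : link k w w' -> occurs_refob k w'.
Proof.
case=> [c|m]; first by apply: occurs_know c _; rewrite !inE eqxx orbT.
by right; exists (target w), (Info w w'); rewrite !inE eqxx orbT.
Qed.

Lemma rooted_occurs es k w : rooted es k w -> occurs_refob k w.
Proof.
case=> [{}w c _|w0 {}w _ _ l _]; last exact: link_occurs l.
by apply: occurs_know c _; rewrite inE.
Qed.

(** A link survives until its Info message is delivered, which makes [w'] a root by itself. The
    target is internal, so the message cannot be dropped as external. *)
Lemma rooted_step h es k e k' w :
  consistent h es k -> step h k e k' -> rooted es k w ->
  target w \in domf (actors k) -> ~~ has (frees w) (rcons es e) ->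
  rooted (rcons es e) k' w.
Proof.
move=> I st; have I' := consistent_step I st; have kh := inv_in I.
elim=> {w} [w c nf _ nf'|w w' _ IH tw l nf dw nf'].
  case: (step_created kh st c) => [c'|/(inv_released I)];
    last by rewrite (negPf nf).
  exact: rooted_created.
have root : Created w' \in K k' (target w') -> rooted (rcons es e) k' w'.
  by move=> c; apply: rooted_created.
have ext : target w \notin externals k.
  by apply/negP => /(inv_ext I); rewrite -tw dw.
suff [l'|/root//] : link k' w w' \/ Created w' \in K k' (target w').
  apply: (rooted_link _ tw l' nf').
  by apply: IH (link_not_freed I' l'); rewrite -tw.
case: l => [c|m].
  by case: (step_using kh st c) => [|[_]]; left; [left|right].
by rewrite tw; case: (step_info st m ext) => ?; [left; right|right].
Qed.

(* External actors need not report the refobs that they create, so a refob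
   that is not rooted can only be traced back to its target being a
     receptionist. *)
Record reachable es k : Prop := Reachable {
  reach_live : forall w, live k w -> target w \in domf (actors k) ->
    rooted es k w \/ target w \in receptionists k;
  reach_rec : forall B, B \in receptionists k ->
    exists w, [/\ target w = B, owner w \notin domf (actors k)
                & rooted es k w]
}.

(** The new cases are Spawn, Send, and messages from outside; an internal owner sends only along
    refobs that are already active. *)
Lemma live_step h es k e k' w :
  consistent h es k -> step h k e k' -> live k' w ->
  live k w \/
  [\/ Created w \in K k' (target w),
      exists y, [/\ link k' y w, target w = target y
                  & Activated y \in K k (owner y)]
    | target w \in domf (actors k') -> target w \in receptionists k'].
Proof.
move=> I st; have kh := inv_in I; case=> [a|c|a].
- have [a'|[_ _]|[x [R [_ wR ek]]]] := step_activated_back st a.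
  + by left; constructor 1.
  + by right; constructor 1.
  + by left; constructor 2; rewrite ek count_mset1D {1}/carries /= wR.
- have [le|[_ _ [y|r]]] := step_carries w kh st.
  + by left; constructor 2; apply: leq_trans le.
  + by right; constructor 2.
  + by right; constructor 3.
- have [p|np] := posnP (count (along w) (undelivered k)); last first.
    by left; constructor 3.
  have : sends w e by have := step_count_along w st; lia.
  case/(step_sends st) => [act|[[z]|[_ r]]].
  + by left; constructor 1.
  + by case/(inv_using I) => _ _ act; left; constructor 1.
  + by right; constructor 3 => _; apply: step_receptionists st r.
Qed.

(** A refob created by Send inherits the root of the active refob it was created from. An actor
    becomes a receptionist when a refob [z] to it reaches an external actor: either [z] is rooted
    and serves as witness, or its target was a receptionist already. *)
Lemma reachable_step h es k e k' :
  consistent h es k -> reachable es k -> step h k e k' ->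
  reachable (rcons es e) k'.
Proof.
move=> I Re st; have I' := consistent_step I st; have kh := inv_in I.
have dom_occ w : target w \in domf (actors k') -> occurs_refob k w ->
    target w \in domf (actors k).
  by move=> /(step_dom_back st)[//|[/fresh_actor_target uw _ _]] /(uw k kh).
have odom_occ w : owner w \notin domf (actors k) -> occurs_refob k w ->
    owner w \notin domf (actors k').
  move=> nd o; apply/negP => /(step_dom_back st)[|[/fresh_actor_owner uw _ _]].
    exact/negP.
  exact: (uw k kh).
have keep w : rooted es k w -> target w \in domf (actors k) ->
    owner w \notin domf (actors k) -> rooted (rcons es e) k' w.
  move=> rw dw nd; apply: (rooted_step I st rw dw).
  (* Freeing presupposes a drop, which only an internal owner can make. *)
  apply/negP => /(inv_freed I')[/(inv_drops I') d _]; move: d; apply/negP.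
  exact: (odom_occ _ nd (rooted_occurs rw)).
have old w : live k w -> target w \in domf (actors k') ->
    ~~ has (frees w) (rcons es e) ->
    rooted (rcons es e) k' w \/ target w \in receptionists k'.
  move=> lw dw nf; have dw' := dom_occ _ dw (live_occurs lw).
  case: (reach_live Re lw dw') => [rw|r]; last first.
    by right; apply: step_receptionists st r.
  by left; apply: (rooted_step I st rw dw' nf).
split=> [w lw dw|B].
  have nf := live_not_freed I' lw.
  have [lw0|[c|[y [l tw act]]|r]] := live_step I st lw.
  - exact: old.
  - by left; apply: rooted_created.
  - have ly : live k y by constructor 1.
    rewrite tw in dw *.
    have [ry|] := old y ly dw (link_not_freed I' l); last by right.
    by left; apply: (rooted_link ry tw l nf).
  - by right; apply: r.
move=> /(step_receptionists_back st)[Br|[C [x [R [z [Cx mC zR tz dB]]]]]].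
  have [w [tw ow rw]] := reach_rec Re Br; exists w; split=> //.
    exact: (odom_occ _ ow (rooted_occurs rw)).
  by apply: keep => //; rewrite tw; apply: (inv_rec I).
have lz : live k z.
  by constructor 2; apply: count_mset_gt0 mC _; rewrite /carries.
have nz : owner z \notin domf (actors k).
  by rewrite (inv_app I mC zR); apply: (inv_ext I).
rewrite -tz in dB *.
case: (reach_live Re lz dB) => [rz|Br].
  by exists z; split=> //; [apply: (odom_occ _ nz (rooted_occurs rz))|apply:
    keep].
have [w [tw ow rw]] := reach_rec Re Br; exists w; split=> //.
  exact: (odom_occ _ ow (rooted_occurs rw)).
by apply: keep => //; rewrite tw.
Qed.

Lemma consistent_initial k : initial k -> consistent [:: k] [::] k.
Proof.
case=> A [E [t [u [nAE ntu ->]]]].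
have know_init B : know [fmap].[A <- Busy [fset Activated (Refob t A E);
    Created (Refob u A A); Activated (Refob u A A)]] B =
    if B == A then [fset Activated (Refob t A E);
    Created (Refob u A A); Activated (Refob u A A)] else fset0.
  by rewrite know_set; case: eqP => //= _; apply: know_notin; rewrite inE.
split=> //=; try by left.
all: rewrite /initial_config /=.
- move=> B; rewrite !inE => /eqP ->; rewrite orbF; exact/eqP/nesym.
- by move=> B x R; rewrite in_mset0.
- by move=> C y z; rewrite in_mset0.
- by move=> B y z; rewrite know_init; case: eqP => _; rewrite ?mem_factE.
- by move=> w; rewrite enum_mset0 addn0 /=; case: (_ \in _).
- move=> w n _ _; rewrite know_init => /derives_sentP[|[]//].
  by case: eqP => _; rewrite ?mem_factE.
- by move=> B y; rewrite know_init; case: eqP => _; rewrite ?mem_factE.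
- move=> w n _; rewrite know_init => /derives_recvP[|[]//].
  by case: eqP => _; rewrite ?mem_factE.
- by move=> w; rewrite enum_mset0.
- by move=> B w n; rewrite in_mset0.
Qed.

Lemma reachable_initial k : initial k -> reachable [::] k.
Proof.
case=> A [E [t [u [nAE ntu ->]]]]; split=> //= w.
case; rewrite /= ?enum_mset0 //= know_set; case: eqP => [_|_].
  (* The first refob targets the external [E]; the second is the self-refob of [A], which [A] knows
     as created. *)
  rewrite !mem_factE /= orbF => /orP[]/eqP-> /=; rewrite !inE ?orbF.
    by move=> /eqP eE; case: nAE.
  by left; apply: rooted_created; rewrite //= know_set eqxx !mem_factE /= eqxx.
by rewrite know_notin // inE.
Qed.

(** * Snapshots in an execution *)

Lemma step_recvs h k e k' w :
  step h k e k' -> recvs w e -> 0 < count (along w) (undelivered k).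
Proof.
by move=> st; case_step st => //= xw; apply: count_mset_gt0; eassumption.
Qed.

Lemma step_snapshot h k A Psi k' :
  step h k (ESnapshot A Psi) k' -> (actors k).[? A] = Some (Idle Psi).
Proof.
suff gen e : step h k e k' ->
    if e is ESnapshot D Psi' then (actors k).[? D] = Some (Idle Psi') else True.
  exact: gen.
by move=> st; case_step st.
Qed.

(** Without receipts, an idle actor can only undergo Release, Compaction and Snapshot. Compaction
    may erase [Created] facts, hence the one-way clause for them. *)
Lemma step_idle_actor h es k e k' A Psi :
  consistent h es k -> step h k e k' ->
  (actors k).[? A] = Some (Idle Psi) ->
  (forall w, target w = A -> recvs w e = false) ->
  [/\ exists Psi', (actors k').[? A] = Some (Idle Psi'),
      forall w, owner w = A -> sends w e = false,
      forall w, Created w \in K k' A -> Created w \in K k A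
    & forall w w', (CreatedUsing w w' \in K k' A) =
                   (CreatedUsing w w' \in K k A)].
Proof.
move=> I st; have kh := inv_in I; have infoP := inv_info I.
move: I kh infoP; case_step st => /= I kh infoP EA nr.
- have nB : A <> B'.
    by move=> eA; have := fresh_actor_dom fB kh; rewrite -eA (mem_dom EA).
  have nA : A <> A' by move=> eA; move: HA; rewrite -eA EA.
  by split=> // [|w|w w']; rewrite ?know_set ?fnd_set; case: eqP => // _;
    case: eqP => //; exists Psi.
- have nA : A <> A' by move=> eA; move: HA; rewrite -eA EA.
  split=> [|w ow|w|w w']; rewrite ?know_set ?fnd_set; try by case: eqP => //;
    exists Psi.
  by apply/eqP => xw; apply: nA; rewrite -ow -xw.
- have nB : A <> B' by move=> eA; have := nr x;
    rewrite eqxx tx eA => /(_ erefl).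
  by split=> // [|w|w w']; rewrite ?know_set ?fnd_set; case: eqP => //;
    exists Psi.
- have nA : A <> A' by move=> eA; move: HA; rewrite -eA EA.
  by split=> // [|w|w w']; rewrite ?know_set ?fnd_set; case: eqP => //;
    exists Psi.
- have nA : A <> A' by move=> eA; move: HA; rewrite -eA EA.
  split=> [|w ow|w|w w']; rewrite ?know_set ?fnd_set; try by case: eqP => //;
    exists Psi.
  by apply/eqP => xw; apply: nA; rewrite -ow -xw.
- have nC : A <> C'.
    by move=> eA; have := nr y; rewrite eqxx (infoP _ _ _ mC) eA => /(_ erefl).
  by split=> // [|w|w w']; rewrite ?know_set ?fnd_set; case: eqP => //;
    exists Psi.
- have nA : A <> A' by move=> eA; move: HA; rewrite -eA EA.
  by split=> // [|w|w w']; rewrite ?know_set ?fnd_set; case: eqP => //;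
    exists Psi.
- have [->|/negPf nB] := eqVneq A B'; last first.
    by split=> // [|w|w w']; rewrite ?know_set ?fnd_set nB //; exists Psi.
  split=> // [|w|w w']; rewrite ?know_set ?fnd_set eqxx /=; first by eexists.
    by rewrite !mem_factE (know_some HB).
  by rewrite !mem_factE (know_some HB).
- have [->|/negPf nC] := eqVneq A C'; last first.
    by split=> // [|w|w w']; rewrite ?know_set ?fnd_set nC //; exists Psi.
  split=> // [|w|w w']; rewrite ?know_set ?fnd_set eqxx /=; first by eexists.
    by rewrite !mem_factE /= andbT (know_some HC) => /andP[].
  by rewrite !mem_factE /= andbT (know_some HC).
- by split=> //; exists Psi.
- split=> // [|w ow]; first by exists Psi.
  by apply/eqP => xw; move: ox; rewrite xw ow (mem_dom EA).
all: by split=> //; exists Psi.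
Qed.

Lemma In_onth (T : Type) (s : seq T) a :
  List.In a s -> exists i, onth s i = Some a.
Proof.
elim: s => [|b s IH] //= [->|/IH[i si]]; first by exists 0.
by exists i.+1.
Qed.

Lemma leq_count_take (T : Type) (P : pred T) (s : seq T) i j :
  i <= j -> count P (take i s) <= count P (take j s).
Proof.
by move=> /take_takel <-; rewrite -[in leqRHS](cat_take_drop i (take j s))
  count_cat leq_addr.
Qed.

Lemma execution_step k0 tr i e :
  execution k0 tr -> onth (unzip1 tr) i = Some e ->
  exists2 k, take i.+1 tr = rcons (take i tr) (e, k)
    & step (k0 :: unzip2 (take i tr)) (last k0 (unzip2 (take i tr))) e k.
Proof.
elim=> {tr} [_|tr e' k ex IH st]; first by rewrite onth0n.
rewrite -cats1 /unzip1 map_cat onth_cat size_map; case: ltnP => [lt|le].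
  by move=> /IH; rewrite !takel_cat // ltnW.
move=> /onth1P[/eqP]; rewrite subn_eq0 => ge /= <-.
have <- : size tr = i by apply/eqP; rewrite eqn_leq le.
have -> : take (size tr) (tr ++ [:: (e', k)]) = tr by apply: take_size_cat.
by exists k => //; rewrite take_oversize ?size_cat ?addn1 // cats1.
Qed.

Section Execution.
Variables (k0 : config) (tr : seq (event * config)).
Hypothesis Hexec : execution k0 tr.

(** Time [i] is the moment after the first [i] events; past the end of the trace everything stays
    constant. *)
Let hist i := k0 :: unzip2 (take i tr).
Let cfg i := last k0 (unzip2 (take i tr)).
Let evs i := take i (unzip1 tr).

Lemma step_at i e : onth (unzip1 tr) i = Some e ->
  [/\ step (hist i) (cfg i) e (cfg i.+1), evs i.+1 = rcons (evs i) e
    & hist i.+1 = rcons (hist i) (cfg i.+1)].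
Proof.
case/(execution_step Hexec) => k ek st.
by rewrite /hist /cfg /evs -!map_take ek /unzip1 /unzip2 !map_rcons last_rcons.
Qed.

Lemma stop_at i : onth (unzip1 tr) i = None ->
  [/\ cfg i.+1 = cfg i, evs i.+1 = evs i & hist i.+1 = hist i].
Proof.
move=> E; have : size (unzip1 tr) <= i by rewrite -onthNE E.
rewrite size_map => le.
by rewrite /hist /cfg /evs !take_oversize ?size_map // leqW.
Qed.

Lemma consistent_at i :
  consistent (hist i) (evs i) (cfg i) /\ reachable (evs i) (cfg i).
Proof.
elim: i => [|i [I R]].
  rewrite /hist /cfg /evs !take0 /=.
  have ini : initial k0 by elim: Hexec.
  by split; [apply: consistent_initial|apply: reachable_initial].
case E: (onth (unzip1 tr) i) => [e|]; last by have [-> -> ->] := stop_at E.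
have [st -> ->] := step_at E.
by split; [apply: consistent_step I st|apply: reachable_step I R st].
Qed.

Lemma dom_mono i j A :
  i <= j -> A \in domf (actors (cfg i)) -> A \in domf (actors (cfg j)).
Proof.
move=> /subnK <-; elim: (j - i) => [//|n IH] /IH; rewrite addSn.
case E: (onth (unzip1 tr) (n + i)) => [e|]; last by have [->] := stop_at E.
by have [st _ _] := step_at E; apply: step_dom st.
Qed.

Lemma hist_mono i j k : i <= j -> List.In k (hist i) -> List.In k (hist j).
Proof.
move=> /subnK <-; elim: (j - i) => [//|n IH] /IH; rewrite addSn.
case E: (onth (unzip1 tr) (n + i)) => [e|]; last by have [_ _ ->] := stop_at E.
by have [_ _ ->] := step_at E; rewrite In_rcons; left.
Qed.

Lemma not_freed_before i j w :
  i <= j -> ~~ has (frees w) (evs j) -> ~~ has (frees w) (evs i).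
Proof.
move=> le; rewrite !has_count -!eqn0Ngt -!leqn0; apply: leq_trans.
exact: leq_count_take.
Qed.

(** An actor spawned after time [i] is fresh, so it cannot own a refob that occurs at time [i]. *)
Lemma owner_dom_occurs i j w :
  occurs_refob (cfg i) w -> owner w \in domf (actors (cfg j)) ->
  owner w \in domf (actors (cfg i)).
Proof.
move=> o; have [/dom_mono|/ltnW /subnK <-] := leqP j i; first exact.
elim: (j - i) => [//|n IH]; rewrite addSn.
case E: (onth (unzip1 tr) (n + i)) => [e|]; last by have [->] := stop_at E.
have [st _ _] := step_at E.
move=> /(step_dom_back st)[//|[/fresh_actor_owner uw _ _]];
  case: (uw (cfg i)) => //.
by apply: (@hist_mono i); [apply: leq_addl|apply: inv_in (consistent_at i).1].
Qed.

(** Only SendInfo erases the fact, and it is itself a send along [w]. *)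
Lemma using_until i j A w w' :
  i <= j -> count (sends w) (evs j) <= count (sends w) (evs i) ->
  CreatedUsing w w' \in K (cfg i) A -> CreatedUsing w w' \in K (cfg j) A.
Proof.
move=> /subnK <-; elim: (j - i) => [//|n IH]; rewrite addSn => le c.
have le' : count (sends w) (evs (n + i)) <= count (sends w) (evs i).
  by apply: leq_trans le; apply: leq_count_take.
have := IH le' c.
case E: (onth (unzip1 tr) (n + i)) => [e|]; last by have [->] := stop_at E.
have [st ee _] := step_at E.
case/(step_using (inv_in (consistent_at (n + i)).1) st) => // -[es _].
have : count (sends w) (evs i) <= count (sends w) (evs (n + i)).
  by apply: leq_count_take; apply: leq_addl.
by move: le; rewrite ee count_rcons es /= eqxx; lia.
Qed.

(** * Finalized snapshots: no receipt after a snapshot *)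

Variable Q : snapshots Token Actor.
Hypotheses (Htaken : taken_in Q tr) (Hfin : finalized Q).

Definition snapped i A Phi :=
  Q.[? A] = Some Phi /\ onth (unzip1 tr) i = Some (ESnapshot A Phi).

Lemma snappedP A Phi : Q.[? A] = Some Phi -> exists i, snapped i A Phi.
Proof. by move=> QA; have [i] := In_onth (Htaken QA); exists i. Qed.

Lemma snapped_state i A Phi :
  snapped i A Phi -> (actors (cfg i)).[? A] = Some (Idle Phi).
Proof. by case=> _ /step_at[/step_snapshot]. Qed.

Lemma snapped_know i A Phi : snapped i A Phi -> K (cfg i) A = Phi.
Proof. by move=> /snapped_state/know_some. Qed.

Definition settled t i A Phi :=
  [/\ exists Psi, (actors (cfg t)).[? A] = Some (Idle Psi),
      forall w, owner w = A ->
        count (sends w) (evs t) = count (sends w) (evs i),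
      forall w, Created w \in K (cfg t) A -> Created w \in Phi
    & forall w w', (CreatedUsing w w' \in K (cfg t) A) =
                   (CreatedUsing w w' \in Phi)].

(** The absence of receipts after a snapshot, expressed through its effects up to time [t]. *)
Definition quiescent t :=
  forall i A Phi, snapped i A Phi -> i <= t -> settled t i A Phi.

Lemma chain_rcons w w' :
  chain Q w -> target w' = target w -> Qderives Q (CreatedUsing w w') ->
  ~ Qderives Q (Released w') -> chain Q w'.
Proof.
case=> x1 [s [lw tw root links]] tw' cu nr; exists x1, (rcons s w'); split=> //.
- by rewrite last_rcons.
- move=> y; rewrite -rcons_cons mem_rcons inE => /predU1P[->//|/tw ->//].
- move=> i; rewrite size_rcons ltnS -rcons_cons !nth_rcons /= => le.
  rewrite ltnS le; move: le; rewrite leq_eqVlt => /predU1P[->|lt].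
    by rewrite ltnn eqxx (nth_last x1 (x1 :: s)) /= lw.
  by rewrite lt; apply: links.
Qed.

(* The counts agree in Q, so the sends recorded by the owner's snapshot were
   all received when the target's snapshot was taken, whichever came first. *)
Lemma chain_quiet t iB B PhiB w :
  quiescent t -> snapped iB B PhiB -> iB <= t -> target w = B ->
  ~~ has (frees w) (evs t) -> chain Q w ->
  [/\ owner w \in domf Q, count (along w) (undelivered (cfg t)) = 0
    & forall w', CreatedUsing w w' \in K (cfg t) (owner w) ->
        Qderives Q (CreatedUsing w w')].
Proof.
move=> q sB iBt tw nf ch.
have dB : B \in domf Q by rewrite -fndSome sB.1.
have [dD [n [[PhiD QD /derives_activated act] [PhiD' QD' sent] [PhiB' QB'
  recv]]]] :=
  Hfin dB tw ch.
move: QD' QB' sent recv; rewrite QD tw sB.1 => -[<-] [<-] sent recv.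
have [iD sD] := snappedP QD.
have ID := (consistent_at iD).1; have IB := (consistent_at iB).1.
rewrite -(snapped_know sD) in act sent; rewrite -tw in sB.
rewrite -(snapped_know sB) in recv.
have nfB : ~~ has (frees w) (evs iB).
  exact: (not_freed_before iBt).
have en := inv_sent ID (activated_drops ID act) (know_mem_dom act) sent.
have em := inv_recv IB nfB recv.
have al := inv_along (consistent_at t).1 w.
have rt := leq_count_take (recvs w) (unzip1 tr) iBt.
(* A past snapshot of the owner has frozen its sends by quiescence; before a future one, sends can
   only grow up to [n]. *)
have st : count (sends w) (evs t) <= n.
  have [le|/ltnW le] := leqP iD t; last by rewrite en; apply: leq_count_take.
  by have [_ /(_ w erefl) -> _ _] := q _ _ _ sD le; rewrite en.
split=> //; first by move: al rt st; rewrite em /evs; lia.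
move=> w' c; exists PhiD => //; apply: derives_mem.
have [le|/ltnW le] := leqP iD t.
  by have [_ _ _ <-] := q _ _ _ sD le.
(* The [n] messages were received by time [iB], hence sent by time [t]: nothing is sent along [w]
   between [t] and the owner's snapshot. *)
rewrite -(snapped_know sD); apply: using_until le _ c.
by rewrite -en em; move: al rt; rewrite /evs; lia.
Qed.

Lemma not_released_at t iB B PhiB w :
  snapped iB B PhiB -> iB <= t -> target w = B -> ~~ has (frees w) (evs t) ->
  ~ Qderives Q (Released w).
Proof.
move=> sB le tw nf [Phi]; rewrite tw sB.1 => -[<-] /derives_released.
rewrite -(snapped_know sB) => /(inv_released (consistent_at iB).1); apply/negP.
exact: (not_freed_before le).
Qed.

(** Once the chain reaches [w], [chain_quiet] rules out an Info message as the next link and puts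
    the other kind of link into [Q]. *)
Lemma rooted_chain t iB B PhiB w :
  quiescent t -> snapped iB B PhiB -> iB <= t -> target w = B ->
  rooted (evs t) (cfg t) w -> chain Q w.
Proof.
move=> q sB le tw rw; elim: rw tw => {w} [w c nf tw|w w' rw IH tw' l nf' tw].
  exists w, [::]; split=> //; first by move=> y; rewrite inE => /eqP->.
  split; last exact: not_released_at sB le tw nf.
  exists PhiB; first by rewrite tw sB.1.
  by apply: derives_mem; have [_ _ cr _] := q _ _ _ sB le; apply: cr;
    rewrite -tw.
rewrite tw' in tw; have ch := IH tw.
have [_ a0 cu] := chain_quiet q sB le tw (link_not_freed (consistent_at t).1 l)
  ch.
case: l => [c|m]; last first.
  by have := count_mset_gt0 (P := along w) m;
    rewrite a0 /along /= eqxx => /(_ erefl).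
apply: (chain_rcons ch tw' (cu _ c)).
by apply: not_released_at sB le _ nf'; rewrite tw'.
Qed.

Lemma live_chain t iB B PhiB w :
  quiescent t -> snapped iB B PhiB -> iB <= t -> target w = B ->
  live (cfg t) w -> chain Q w.
Proof.
move=> q sB le tw lw; have [I R] := consistent_at t.
have [[Psi /mem_dom dB] _ _ _] := q _ _ _ sB le.
have [] := reach_live R lw; first by rewrite tw.
  exact: rooted_chain sB le tw.
(* A receptionist has a rooted refob [v] with external owner. Its chain would put that owner into
   [Q], making it internal at its snapshot and, since [v] occurs at time [t], already then. *)
move=> /(reach_rec R)[v [tv ov rv]].
have rootv := rooted_chain q sB le (etrans tv tw) rv.
have dBQ : B \in domf Q by rewrite -fndSome sB.1.
have [dv _] := Hfin dBQ (etrans tv tw) rootv.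
case Qv: (Q.[? owner v]) => [Phi|]; last by move: dv; rewrite -fndSome Qv.
have [j /snapped_state/mem_dom dj] := snappedP Qv.
by case/negP: ov; apply: owner_dom_occurs (rooted_occurs rv) dj.
Qed.

(** By induction on time: a receipt along [w] after the snapshot needs a message in transit along
    [w], so [w] is live and has a chain, but chains leave nothing in transit. *)
Lemma quiescent_at t : quiescent t.
Proof.
have base i A Phi : snapped i A Phi -> settled i i A Phi.
  by move=> s; rewrite /settled (snapped_know s); split=> //; exists Phi;
    apply: snapped_state.
elim: t => [|t IH] i A Phi s.
  by rewrite leqn0 => /eqP ei; rewrite ei in s *; apply: base.
rewrite leq_eqVlt ltnS => /predU1P[ei|le]; first by rewrite -ei; apply: base.
have [[Psi EA] sd cr cu] := IH _ _ _ s le.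
case E: (onth (unzip1 tr) t) => [e|]; last first.
  by rewrite /settled; have [-> -> _] := stop_at E; apply: IH.
have [st ee _] := step_at E; have I := (consistent_at t).1.
have nr w : target w = A -> recvs w e = false.
  move=> tw; apply/negP => /(step_recvs st) a.
  have lw : live (cfg t) w by constructor 3.
  have [_ a0 _] := chain_quiet IH s le tw (live_not_freed I lw)
    (live_chain IH s le tw lw).
  by rewrite a0 in a.
have [Id ns cr' cu'] := step_idle_actor I st EA nr; split=> //.
- by move=> w ow; rewrite ee count_rcons (ns _ ow) sd.
- by move=> w /cr'/cr.
- by move=> w w'; rewrite cu' cu.
Qed.

Lemma finalized_strongly : strongly_finalized Q.
Proof.
move=> B x dB tx [nr cr]; apply: (Hfin dB tx _).2.
case: cr => [c|[C [y [PhiC QC /derives_using yx]]]].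
  by exists x, [::]; split=> // y; rewrite inE => /eqP->.
case QB: (Q.[? B]) => [PhiB|]; last by move: dB; rewrite -fndSome QB.
have [iB sB] := snappedP QB; have [iC sC] := snappedP QC.
(* At the later of the two snapshots both actors are settled: [C] still holds [CreatedUsing y x], so
   it owns [y] and [y] is active. *)
pose t := maxn iB iC; have q := @quiescent_at t.
have leB : iB <= t by apply: leq_maxl.
have leC : iC <= t by apply: leq_maxr.
have [_ _ _ cu] := q _ _ _ sC leC; have yxt := yx; rewrite -cu in yxt.
have [oy txy act] := inv_using (consistent_at t).1 yxt.
apply: (@chain_rcons y) => //; last by exists PhiC;
  [rewrite oy|apply: derives_mem].
apply: (live_chain q sB leB); first by rewrite -txy.
by constructor 1; rewrite oy.
Qed.

End Execution.

End Protocol.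

Theorem theorem6p14 (Token Actor : choiceType) (k0 : config Token Actor)
    (tr : seq (event Token Actor * config Token Actor))
    (Q : snapshots Token Actor)
    (Hexec : execution k0 tr) (Htaken : taken_in Q tr)
    (Hfin : finalized Q) :
  strongly_finalized Q.
Proof. exact: (finalized_strongly Hexec Htaken Hfin). Qed.
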